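(* Let $\mathcal{K}$ be a compact second-countable Hausdorff space, let $\mathcal{C}$ be the set of continuous functions $\mathcal{K}\to\mathbb{R}$, let $\mathcal{F}\subseteq\mathcal{C}$ be a countable generating set, and let $W_1,W_2,\dots$ be a sequence of $\mathcal{K}$-graphons such that $(t(F,W_n):n=1,2,\dots)$ is a convergent sequence for every $\mathcal{F}$-decorated graph $F$. Then there is a $\mathcal{K}$-graphon $W$ such that $t(F,W_n)\to t(F,W)$ for every $\mathcal{C}$-decorated graph $F$.
   Context: A set $\mathcal{F}\subseteq\mathcal{C}$ is a generating set if its linear span is dense in $\mathcal{C}$ in supremum norm. For $\mathcal{F}'\subseteq\mathcal{C}$, an $\mathcal{F}'$-decorated graph on $[k]$ is a symmetric map $F:[k]\times[k]\to\mathcal{F}'$, with entries $F_{i,j}$. Let $\mathcal{P}(\mathcal{K})$ be the space of Borel probability measures on $\mathcal{K}$ with the weak topology. A $\mathcal{K}$-graphon is a Borel measurable map $W:[0,1]^2\to\mathcal{P}(\mathcal{K})$ with $W(x,y)=W(y,x)$ for all $x,y$. For $f\in\mathcal{C}$, $W_f(x,y)=\int_{\mathcal{K}}f\,dW(x,y)$, and for a $\mathcal{C}$-decorated graph $F$ on $[k]$, $t(F,W)=\int_{[0,1]^k}\prod_{1\le i<j\le k}W_{F_{i,j}}(x_i,x_j)\,dx_1\cdots dx_k$. *)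

(* Defs.v *)
From HB Require Import structures.
From mathcomp Require Import all_boot all_order all_algebra.
From mathcomp Require Import all_classical all_reals all_analysis.
Set Implicit Arguments. Unset Strict Implicit. Unset Printing Implicit Defensive.
Import Order.TTheory GRing.Theory Num.Theory numFieldNormedType.Exports.
Local Open Scope classical_set_scope.
Local Open Scope ring_scope.

Section Defs.
Context (R : realType) (K : ptopologicalType).

Definition borelK : measurableType (@open K).-sigma := g_sigma_algebraType (@open K).

(** P(K): Borel probability measures on K, with the sigma-algebra generated by
    the evaluations mu |-> mu U (U Borel). *)
Definition PK := pprobability borelK R.

Definition I01 : set R := `[0, 1].

Definition contK : set (K -> R) := [set f | continuous f].

Definition generating (Fs : set (K -> R)) : Prop :=
  Fs `<=` contK /\
  forall g : K -> R, continuous g -> forall eps : R, 0 < eps ->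
    exists (n : nat) (c : 'I_n -> R) (h : 'I_n -> K -> R),
      (forall i, Fs (h i)) /\
      forall x : K, `| g x - \sum_(i < n) c i * h i x | < eps.

Definition decorated (Fs : set (K -> R)) (k : nat) (F : 'I_k -> 'I_k -> K -> R) : Prop :=
  (forall i j, F i j = F j i) /\ (forall i j, Fs (F i j)).

(** K-graphon: a Borel measurable symmetric map [0,1]^2 -> P(K)
    (represented as a map on R * R, of which only [0,1]^2 matters) *)
Definition Kgraphon (W : R * R -> PK) : Prop :=
  measurable_fun (I01 `*` I01) W /\
  (forall x y, I01 x -> I01 y -> W (x, y) = W (y, x)).

Definition Wf (W : R * R -> PK) f (x y : R) : R :=
  Rintegral (W (x, y) : probability borelK R) setT f.

(** iterated Lebesgue integral over [0,1]^k of g : (nat -> R) -> R,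
    coordinates 0..k-1 *)
Fixpoint iter_int (k : nat) (g : (nat -> R) -> R) : R :=
  match k with
  | 0 => g (fun _ => 0)
  | k'.+1 => Rintegral lebesgue_measure I01
      (fun t => iter_int k' (fun v => g (fun i => if i == k' then t else v i)))
  end.

Definition tdens (k : nat) (F : 'I_k -> 'I_k -> K -> R) (W : R * R -> PK) : R :=
  iter_int k (fun x => \prod_(i < k) \prod_(j < k | (i < j)%N) Wf W (F i j) (x i) (x j)).

End Defs.

(* Main.v *)
Require Import Defs.
From HB Require Import structures.
From mathcomp Require Import all_boot all_order all_algebra.
From mathcomp Require Import all_classical all_reals all_analysis.
From mathcomp Require Import measurable_realfun ring lra.
Import Order.TTheory GRing.Theory Num.Theory numFieldNormedType.Exports.
Local Open Scope classical_set_scope.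
Local Open Scope ring_scope.
Set Implicit Arguments. Unset Strict Implicit. Unset Printing Implicit Defensive.

(* Pass to the limit along an ultrafilter on [nat] finer than [\oo]; no diagonal
   extraction is needed, and the hypothesis on [Fs] is used only at the end, to
   identify the limits along [\oo].

   A countable base of [K] cuts it into a binary tree of Borel cells, and [W n]
   becomes a countable family of [0,1]-valued kernels [W n z (cell s)]. For such
   a family, choose countably many sets A_1, A_2, ... in [0,1] (internal sets, one
   representative per [n]) so that the limit along the ultrafilter of the L2 energy
   of the averages over the atoms of A_1, ..., A_N has the largest possible
   supremum, simultaneously for all kernels of the family. A set that still
   correlated with the difference between a kernel and its average would
   increase that energy, so the averages approximate the kernels in cut norm, and
   the counting lemma shows that homomorphism densities converge to those of the
   averages. Masses and averages have limits along the ultrafilter; coding the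
   atoms by nested subintervals of [0,1] turns the limits into step kernels that
   are Cauchy in L2, and their limits [u s] have the right densities.

   Additivity in [s] survives almost everywhere, so [s |-> u s z] is the mass of a
   measure on branches of the tree. A uniform random variable run through the
   interval code for [u _ z] picks a branch, hence a point of [K], and the limit
   graphon is its law. Continuous functions are uniformly close to combinations of
   cells, as they are to combinations of [Fs], and densities are multilinear. *)

(** * Integration of bounded functions on the unit square *)

Section BoundedMeasurable.
Context {R : realType}.

(** All kernels are averaged over the same atoms. Averaging is linear, so the relations between
    cells, namely that two siblings add up to their parent and that the root has mass one, hold
    exactly for the averages and for their limits; separate partitions for separate cells would
    destroy them. Cells rather than continuous functions keep the kernels [0,1]-valued, as the
    counting lemma requires, and these relations alone recover a measure, with no representation
    theorem for positive functionals. The obstacle is that the relations survive only where the step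
    kernels converge. The numbers of sets used are therefore chosen so that successive step kernels
    have summable distances, which gives convergence outside a single null set. The graphon must
    still be measurable, symmetric and probability-valued on the whole square, so the interval code
    and the branch points are defined for arbitrary numbers [u s z]; only their meaning is almost
    everywhere. Cells need not be closed and may be empty: a branch picks its point through closures
    of cells, and branches that meet an empty cell have to be shown to be null. *)

Definition bounded_meas d (T : measurableType d) (f : T -> R) :=
  measurable_fun setT f /\ exists C : R, forall x, `|f x| <= C.

Section closure.
Context d (T : measurableType d).
Implicit Types f g : T -> R.

Lemma bounded_meas_cst (c : R) : bounded_meas (fun _ : T => c).
Proof. by split; [exact: measurable_cst | exists `|c|]. Qed.

Lemma bounded_measD f g : bounded_meas f -> bounded_meas g ->
  bounded_meas (fun x => f x + g x).
Proof.
move=> [mf [C hC]] [mg [C' hC']]; split; first exact: measurable_funD.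
by exists (C + C') => x; apply: le_trans (ler_normD _ _) _; rewrite lerD.
Qed.

Lemma bounded_measM f g : bounded_meas f -> bounded_meas g ->
  bounded_meas (fun x => f x * g x).
Proof.
move=> [mf [C hC]] [mg [C' hC']]; split; first exact: measurable_funM.
by exists (C * C') => x; rewrite normrM ler_pM.
Qed.

Lemma bounded_measZ c f : bounded_meas f -> bounded_meas (fun x => c * f x).
Proof. by move=> mf; apply: bounded_measM => //; apply: bounded_meas_cst. Qed.

Lemma bounded_measN f : bounded_meas f -> bounded_meas (fun x => - f x).
Proof.
move=> mf; rewrite (_ : (fun _ => _) = fun x => -1 * f x); first exact: bounded_measZ.
by apply/funext => x; rewrite mulN1r.
Qed.

Lemma bounded_measB f g : bounded_meas f -> bounded_meas g ->
  bounded_meas (fun x => f x - g x).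
Proof. by move=> ? ?; apply: bounded_measD => //; apply: bounded_measN. Qed.

Lemma bounded_meas_norm f : bounded_meas f -> bounded_meas (fun x => `|f x|).
Proof.
move=> [mf [C hC]]; split; first exact: measurableT_comp.
by exists C => x; rewrite normr_id.
Qed.

Lemma bounded_meas_sum (I : Type) (r : seq I) (Q : pred I) (h : I -> T -> R) :
  (forall i, bounded_meas (h i)) -> bounded_meas (fun x => \sum_(i <- r | Q i) h i x).
Proof.
move=> mh; elim: r => [|i r IH].
  by under eq_fun do rewrite big_nil; exact: bounded_meas_cst.
under eq_fun do rewrite big_cons; case: (Q i) => //.
exact: bounded_measD.
Qed.

Lemma bounded_meas_indic (A : set T) : measurable A -> bounded_meas (\1_A : T -> R).
Proof.
move=> mA; split; first exact: measurable_indic.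
by exists 1 => x; rewrite indicE; case: (x \in A); rewrite ?normr1 ?normr0.
Qed.

Lemma bounded_meas_comp d' (T' : measurableType d') (f : T -> R) (g : T' -> T) :
  bounded_meas f -> measurable_fun setT g -> bounded_meas (fun x => f (g x)).
Proof.
by move=> [mf [C hC]] mg; split; [exact: measurableT_comp | exists C].
Qed.

(** Functions built from a graphon are known to be measurable on the unit square only; extension by
    zero makes them total, so that the calculus of [bounded_meas] applies. *)
Lemma bounded_meas_restrict (D : set T) (f : T -> R) (C : R) : measurable D ->
  measurable_fun D f -> (forall x, D x -> `|f x| <= C) -> 0 <= C ->
  bounded_meas (f \_ D).
Proof.
move=> mD mf hC C0; split; first exact: (measurable_restrictT f mD).1.
exists C => x; rewrite /patch; case: ifPn => [xD|_]; last by rewrite normr0.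
by apply: hC; rewrite inE in xD.
Qed.

End closure.

(* A finite measure is used through a set [D] of measure one, so that the
   same lemmas serve [lebesgue_measure] on [0,1], its square, and the
   probability measures [W (x, y)]. *)
Section Mean.
Context d (T : measurableType d) (mu : {measure set T -> \bar R}) (D : set T).
Hypotheses (mD : measurable D) (muD : mu D = 1%E).
Implicit Types f g : T -> R.

Let E f := Rintegral mu D f.

Lemma bounded_meas_integrable f : bounded_meas f -> mu.-integrable D (EFin \o f).
Proof.
move=> [mf [C hC]]; apply: measurable_bounded_integrable => //.
- by rewrite muD ltry.
- exact: measurable_funTS.
- exists C; split; first exact: num_real.
  by move=> M CM x _; rewrite /= (le_trans (hC x))// ltW.
Qed.

Lemma mean_cst c : E (fun=> c) = c.
Proof. by rewrite /E Rintegral_cst// muD mulr1. Qed.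

Lemma eq_mean f g : (forall x, D x -> f x = g x) -> E f = E g.
Proof. by move=> fg; apply: eq_Rintegral => x; rewrite inE => /fg. Qed.

Lemma meanD f g : bounded_meas f -> bounded_meas g ->
  E (fun x => f x + g x) = E f + E g.
Proof. by move=> mf mg; rewrite /E RintegralD//; exact: bounded_meas_integrable. Qed.

Lemma meanB f g : bounded_meas f -> bounded_meas g ->
  E (fun x => f x - g x) = E f - E g.
Proof. by move=> mf mg; rewrite /E RintegralB//; exact: bounded_meas_integrable. Qed.

Lemma meanZ c f : bounded_meas f -> E (fun x => c * f x) = c * E f.
Proof. by move=> mf; rewrite /E RintegralZl//; exact: bounded_meas_integrable. Qed.

Lemma mean_sum (I : Type) (r : seq I) (Q : pred I) (h : I -> T -> R) :
  (forall i, bounded_meas (h i)) ->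
  E (fun x => \sum_(i <- r | Q i) h i x) = \sum_(i <- r | Q i) E (h i).
Proof.
move=> mh; elim: r => [|i r IH].
  by rewrite big_nil -[RHS]mean_cst; apply: eq_mean => x _; rewrite big_nil.
rewrite big_cons; case: ifPn => Qi; last first.
  by rewrite -IH; apply: eq_mean => x _; rewrite big_cons (negbTE Qi).
rewrite -IH -meanD//; last by apply: bounded_meas_sum.
by apply: eq_mean => x _; rewrite big_cons Qi.
Qed.

Lemma le_mean f g : bounded_meas f -> bounded_meas g ->
  (forall x, D x -> f x <= g x) -> E f <= E g.
Proof. by move=> mf mg fg; apply: le_Rintegral => //; exact: bounded_meas_integrable. Qed.

Lemma mean_ge0 f : (forall x, D x -> 0 <= f x) -> 0 <= E f.
Proof. exact: Rintegral_ge0. Qed.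

Lemma ler_norm_mean f : bounded_meas f -> `|E f| <= E (fun x => `|f x|).
Proof. by move=> mf; apply: le_normr_Rintegral => //; exact: bounded_meas_integrable. Qed.

Lemma mean_norm_le f C : bounded_meas f -> (forall x, D x -> `|f x| <= C) -> `|E f| <= C.
Proof.
move=> mf hC; apply: le_trans (ler_norm_mean mf) _; rewrite -[leRHS]mean_cst.
by apply: le_mean => //; [exact: bounded_meas_norm | exact: bounded_meas_cst].
Qed.

(** The difference of the two sides is the variance of [f], the mean of [(f - m) ^+ 2]. *)
Lemma sqr_mean_le f : bounded_meas f -> (E f) ^+ 2 <= E (fun x => f x ^+ 2).
Proof.
move=> mf; set m := E f; rewrite -subr_ge0.
have mf2 : bounded_meas (fun x => f x ^+ 2) by apply: bounded_measM.
have -> : E (fun x => f x ^+ 2) - m ^+ 2 = E (fun x => (f x - m) ^+ 2).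
  transitivity (E (fun x => f x ^+ 2 + (- (2 * m) * f x + m ^+ 2))).
    rewrite meanD//; last by apply: bounded_measD; [exact: bounded_measZ|exact: bounded_meas_cst].
    rewrite meanD; [|exact: bounded_measZ|exact: bounded_meas_cst].
    by rewrite meanZ// mean_cst -/m; ring.
  by apply: eq_mean => x _; ring.
by apply: mean_ge0 => x _; exact: sqr_ge0.
Qed.

Lemma mean_dominated_cvg (f_ : nat -> T -> R) f C :
  (forall n, bounded_meas (f_ n)) -> bounded_meas f ->
  (forall n x, D x -> `|f_ n x| <= C) ->
  {ae mu, forall x, D x -> f_ n x @[n --> \oo] --> f x} ->
  E (f_ n) @[n --> \oo] --> E f.
Proof.
move=> mf_ mf hC ff.
have [] := @dominated_convergence _ _ _ mu D mD (fun n x => (f_ n x)%:E)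
  (EFin \o f) (fun=> C%:E).
- by move=> n; apply/measurable_EFinP; apply: measurable_funTS; exact: (mf_ n).1.
- by apply/measurable_EFinP; apply: measurable_funTS; exact: mf.1.
- by apply: filterS ff => x h /h {}h; apply: cvg_EFin => //; exact: nearW.
- exact: bounded_meas_integrable (bounded_meas_cst _ C).
- by apply: aeW => x n Dx; rewrite lee_fin hC.
move=> intf _ h.
have fin : (\int[mu]_(x in D) (f x)%:E)%E \is a fin_num by exact: integrable_fin_num.
by rewrite /E /Rintegral; apply: fine_cvg; rewrite fineK.
Qed.

End Mean.

End BoundedMeasurable.

(** * Fubini and iterated integration over finitely many coordinates *)

Section UnitSquare.
Context {R : realType}.
Local Notation leb := (@lebesgue_measure R).
Local Notation I := (@I01 R).

Definition mean1 (f : R -> R) : R := Rintegral leb I f.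
Definition mean2 (f : R * R -> R) : R := Rintegral (leb \x leb)%E (I `*` I) f.

Lemma measurable_I01 : measurable I.
Proof. exact: measurable_itv. Qed.

Lemma lebesgue_I01 : leb I = 1%E.
Proof. by rewrite /I01 lebesgue_measure_itv/= lte_fin ltr01 oppr0 adde0. Qed.

Lemma measurable_I01X : measurable (I `*` I).
Proof. by apply: measurableX; exact: measurable_I01. Qed.

Lemma lebesgue2_I01X : (leb \x leb)%E (I `*` I) = 1%E.
Proof.
rewrite product_measure1E; [|exact: measurable_I01..].
by transitivity (1 * 1 : \bar R)%E; [congr (_ * _)%E; exact: lebesgue_I01 | rewrite mule1].
Qed.

Lemma mean1_cst c : mean1 (fun=> c) = c.
Proof. exact: (@mean_cst _ _ _ leb I measurable_I01 lebesgue_I01). Qed.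

Lemma mean1D f g : bounded_meas f -> bounded_meas g ->
  mean1 (fun x => f x + g x) = mean1 f + mean1 g.
Proof. exact: (@meanD _ _ _ leb I measurable_I01 lebesgue_I01). Qed.

Lemma mean1B f g : bounded_meas f -> bounded_meas g ->
  mean1 (fun x => f x - g x) = mean1 f - mean1 g.
Proof. exact: (@meanB _ _ _ leb I measurable_I01 lebesgue_I01). Qed.

Lemma mean1Z c f : bounded_meas f -> mean1 (fun x => c * f x) = c * mean1 f.
Proof. exact: (@meanZ _ _ _ leb I measurable_I01 lebesgue_I01). Qed.

Lemma mean1_sum (J : Type) (r : seq J) (Q : pred J) (h : J -> R -> R) :
  (forall i, bounded_meas (h i)) ->
  mean1 (fun x => \sum_(i <- r | Q i) h i x) = \sum_(i <- r | Q i) mean1 (h i).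
Proof. exact: (@mean_sum _ _ _ leb I measurable_I01 lebesgue_I01). Qed.

Lemma le_mean1 f g : bounded_meas f -> bounded_meas g ->
  (forall x, f x <= g x) -> mean1 f <= mean1 g.
Proof. by move=> bf bg fg; apply: (@le_mean _ _ _ leb I measurable_I01 lebesgue_I01 _ _ bf bg). Qed.

Lemma mean1_norm_le f C : bounded_meas f -> (forall x, `|f x| <= C) -> `|mean1 f| <= C.
Proof. by move=> bf hC; apply: (@mean_norm_le _ _ _ leb I measurable_I01 lebesgue_I01 _ _ bf). Qed.

Lemma mean2_cst c : mean2 (fun=> c) = c.
Proof. exact: (@mean_cst _ _ _ (leb \x leb)%E (I `*` I) measurable_I01X lebesgue2_I01X). Qed.

Lemma mean2D f g : bounded_meas f -> bounded_meas g ->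
  mean2 (fun x => f x + g x) = mean2 f + mean2 g.
Proof. exact: (@meanD _ _ _ (leb \x leb)%E (I `*` I) measurable_I01X lebesgue2_I01X). Qed.

Lemma mean2B f g : bounded_meas f -> bounded_meas g ->
  mean2 (fun x => f x - g x) = mean2 f - mean2 g.
Proof. exact: (@meanB _ _ _ (leb \x leb)%E (I `*` I) measurable_I01X lebesgue2_I01X). Qed.

Lemma mean2Z c f : bounded_meas f -> mean2 (fun x => c * f x) = c * mean2 f.
Proof. exact: (@meanZ _ _ _ (leb \x leb)%E (I `*` I) measurable_I01X lebesgue2_I01X). Qed.

Lemma mean2_sum (J : Type) (r : seq J) (Q : pred J) (h : J -> R * R -> R) :
  (forall i, bounded_meas (h i)) ->
  mean2 (fun x => \sum_(i <- r | Q i) h i x) = \sum_(i <- r | Q i) mean2 (h i).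
Proof. exact: (@mean_sum _ _ _ (leb \x leb)%E (I `*` I) measurable_I01X lebesgue2_I01X). Qed.

Lemma le_mean2 f g : bounded_meas f -> bounded_meas g ->
  (forall x, f x <= g x) -> mean2 f <= mean2 g.
Proof. by move=> bf bg fg; apply: (@le_mean _ _ _ (leb \x leb)%E (I `*` I) measurable_I01X lebesgue2_I01X _ _ bf bg). Qed.

Lemma mean2_norm_le f C : bounded_meas f -> (forall x, `|f x| <= C) -> `|mean2 f| <= C.
Proof. by move=> bf hC; apply: (@mean_norm_le _ _ _ (leb \x leb)%E (I `*` I) measurable_I01X lebesgue2_I01X _ _ bf). Qed.

Lemma mean1_ge0 f : (forall x, 0 <= f x) -> 0 <= mean1 f.
Proof. by move=> f0; apply: mean_ge0 => x _; exact: f0. Qed.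

Lemma mean2_ge0 f : (forall x, 0 <= f x) -> 0 <= mean2 f.
Proof. by move=> f0; apply: mean_ge0 => x _; exact: f0. Qed.

Lemma eq_mean2 f g : (forall z, (I `*` I) z -> f z = g z) -> mean2 f = mean2 g.
Proof. by move=> fg; apply: eq_Rintegral => x; rewrite inE => /fg. Qed.

Lemma ler_norm_mean2 f : bounded_meas f -> `|mean2 f| <= mean2 (fun z => `|f z|).
Proof. exact: (@ler_norm_mean _ _ _ (leb \x leb)%E (I `*` I) measurable_I01X lebesgue2_I01X). Qed.

Lemma sqr_mean2_le f : bounded_meas f -> mean2 f ^+ 2 <= mean2 (fun z => f z ^+ 2).
Proof. exact: (@sqr_mean_le _ _ _ (leb \x leb)%E (I `*` I) measurable_I01X lebesgue2_I01X). Qed.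

(** Measurability of a partial integral comes from Tonelli's theorem for nonnegative functions, so
    [G] is shifted by its bound [C] and cut off by the indicator of [0,1]; the shift is subtracted
    afterwards, [0,1] having measure one. *)
Lemma bounded_meas_mean1 d (T : measurableType d) (G : T * R -> R) :
  bounded_meas G -> bounded_meas (fun z => mean1 (fun t => G (z, t))).
Proof.
move=> bG; have [mG [C hC]] := bG.
have bGz z : bounded_meas (fun t => G (z, t)).
  exact: (bounded_meas_comp bG (pair1_measurable z)).
split; last by exists C => z; apply: mean1_norm_le.
pose H (p : T * R) : \bar R := ((G p + C) * \1_I p.2)%:E.
have H0 p : (0 <= H p)%E.
  rewrite lee_fin mulr_ge0// ?indicE//.
  by have := hC p; rewrite ler_norml => /andP[]; lra.
have mH : measurable_fun setT H.
  apply/measurable_EFinP; apply: measurable_funM.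
    by apply: measurable_funD => //; exact: measurable_cst.
  apply: (@measurableT_comp _ _ _ _ _ _ (\1_I : R -> R) setT (@snd T R)).
    by apply: measurable_indic; exact: measurable_I01.
  exact: measurable_snd.
have := measurable_fun_fubini_tonelli_F (m2 := leb) H mH H0.
move=> mF; have : measurable_fun setT (fun z => fine (fubini_F leb H z) - C).
  apply: measurable_funB; last exact: measurable_cst.
  exact: measurableT_comp.
congr measurable_fun; apply/funext => z.
have -> : fine (fubini_F leb H z) = mean1 (fun t => G (z, t) + C).
  rewrite /mean1 Rintegral_mkcond /Rintegral; congr fine.
  apply: eq_integral => t _; rewrite /H /patch /= indicE.
  by case: (t \in I); rewrite ?mulr1 ?mulr0.
by rewrite mean1D ?mean1_cst ?addrK//; exact: bounded_meas_cst.
Qed.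

Lemma mean2_fubini (G : R * R -> R) : bounded_meas G ->
  mean2 G = mean1 (fun x => mean1 (fun y => G (x, y))).
Proof.
move=> bG; have [mG [C hC]] := bG.
have bF : bounded_meas (fun x => mean1 (fun y => G (x, y))) by exact: bounded_meas_mean1.
have iG : (leb \x leb)%E.-integrable setT (EFin \o (G \_ (I `*` I))).
  rewrite -restrict_EFin; apply/integrable_restrict => //.
    exact: measurable_I01X.
  rewrite setTI; exact: (@bounded_meas_integrable _ _ _ (leb \x leb)%E _ measurable_I01X lebesgue2_I01X _ bG).
rewrite /mean2 Rintegral_mkcond /Rintegral.
rewrite -(integral12_prod_meas1 iG) [in RHS]/mean1 Rintegral_mkcond /Rintegral.
congr fine; apply: eq_integral => x _; rewrite /fubini_F /=.
rewrite /patch; case: ifPn => xI.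
  rewrite /mean1 /Rintegral fineK; last first.
    apply: integrable_fin_num; first exact: measurable_I01.
    apply: (@bounded_meas_integrable _ _ _ leb _ measurable_I01 lebesgue_I01).
    exact: (bounded_meas_comp bG (pair1_measurable x)).
  rewrite [RHS]integral_mkcond; apply: eq_integral => y _.
  by rewrite /patch in_setX xI /=; case: ifP.
by rewrite -[RHS](integral0 leb setT); apply: eq_integral => y _; rewrite in_setX (negbTE xI).
Qed.

Lemma mean2_fubini_sym (G : R * R -> R) : bounded_meas G ->
  mean2 G = mean1 (fun y => mean1 (fun x => G (x, y))).
Proof.
move=> bG; have [mG [C hC]] := bG.
have iG : (leb \x leb)%E.-integrable setT (EFin \o (G \_ (I `*` I))).
  rewrite -restrict_EFin; apply/integrable_restrict => //.
    exact: measurable_I01X.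
  rewrite setTI; exact: (@bounded_meas_integrable _ _ _ (leb \x leb)%E _ measurable_I01X lebesgue2_I01X _ bG).
rewrite /mean2 Rintegral_mkcond /Rintegral.
rewrite -(integral21_prod_meas1 iG) [in RHS]/mean1 Rintegral_mkcond /Rintegral.
congr fine; apply: eq_integral => y _; rewrite /fubini_G /=.
rewrite /patch; case: ifPn => yI.
  rewrite /mean1 /Rintegral fineK; last first.
    apply: integrable_fin_num; first exact: measurable_I01.
    apply: (@bounded_meas_integrable _ _ _ leb _ measurable_I01 lebesgue_I01).
    exact: (bounded_meas_comp bG (pair2_measurable y)).
  rewrite [RHS]integral_mkcond; apply: eq_integral => x _.
  by rewrite /patch in_setX yI andbT /=; case: ifP.
rewrite -[RHS](integral0 leb setT); apply: eq_integral => x _.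
by rewrite in_setX (negbTE yI) andbF.
Qed.

Definition update (x : nat -> R) (i : nat) (t : R) : nat -> R :=
  fun j => if j == i then t else x j.

(* Measurability is tested by composition with measurable coordinates, which
   avoids choosing a sigma-algebra on [nat -> R]. *)
Definition nice (g : (nat -> R) -> R) :=
  (exists C, forall x, `|g x| <= C) /\
  forall d (T : measurableType d) (h : nat -> T -> R),
    (forall i, measurable_fun setT (h i)) ->
    measurable_fun setT (fun z => g (fun i => h i z)).

Lemma nice_bounded_meas d (T : measurableType d) (h : nat -> T -> R) g :
  nice g -> (forall i, measurable_fun setT (h i)) ->
  bounded_meas (fun z => g (fun i => h i z)).
Proof. by move=> [[C hC] mg] mh; split; [exact: mg | exists C => z; exact: hC]. Qed.

Lemma nice_cst c : nice (fun _ => c).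
Proof. by split; [exists `|c| | move=> *; exact: measurable_cst]. Qed.

Lemma niceD a b : nice a -> nice b -> nice (fun x => a x + b x).
Proof.
move=> [[C hC] ma] [[C' hC'] mb]; split.
  by exists (C + C') => x; apply: le_trans (ler_normD _ _) _; rewrite lerD.
by move=> d T h mh; apply: measurable_funD; [exact: ma | exact: mb].
Qed.

Lemma niceM a b : nice a -> nice b -> nice (fun x => a x * b x).
Proof.
move=> [[C hC] ma] [[C' hC'] mb]; split.
  by exists (C * C') => x; rewrite normrM ler_pM.
by move=> d T h mh; apply: measurable_funM; [exact: ma | exact: mb].
Qed.

Lemma niceZ c a : nice a -> nice (fun x => c * a x).
Proof. by move=> na; apply: niceM => //; exact: nice_cst. Qed.

Lemma niceB a b : nice a -> nice b -> nice (fun x => a x - b x).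
Proof.
move=> na nb; rewrite (_ : (fun _ => _) = fun x => a x + -1 * b x).
  by apply: niceD => //; exact: niceZ.
by apply/funext => x; rewrite mulN1r.
Qed.

Lemma nice_prod (J : Type) (r : seq J) (Q : pred J) (h : J -> (nat -> R) -> R) :
  (forall i, nice (h i)) -> nice (fun x => \prod_(i <- r | Q i) h i x).
Proof.
move=> mh; elim: r => [|i r IH].
  by under eq_fun do rewrite big_nil; exact: nice_cst.
under eq_fun do rewrite big_cons; case: (Q i) => //.
exact: niceM.
Qed.

Lemma nice_sum (J : Type) (r : seq J) (Q : pred J) (h : J -> (nat -> R) -> R) :
  (forall i, nice (h i)) -> nice (fun x => \sum_(i <- r | Q i) h i x).
Proof.
move=> mh; elim: r => [|i r IH].
  by under eq_fun do rewrite big_nil; exact: nice_cst.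
under eq_fun do rewrite big_cons; case: (Q i) => //.
exact: niceD.
Qed.

Lemma nice_kernel (w : R * R -> R) i j : bounded_meas w -> nice (fun x => w (x i, x j)).
Proof.
move=> [mw [C hC]]; split; first by exists C.
move=> d T h mh; apply: (measurableT_comp mw).
by apply: measurable_fun_pair => //; exact: mh.
Qed.

Lemma nice_update g x i : nice g -> bounded_meas (fun t => g (update x i t)).
Proof.
move=> ng; apply: nice_bounded_meas => // j; rewrite /update.
by case: (j == i); [exact: measurable_id | exact: measurable_cst].
Qed.

(** An explicit list of coordinates replaces the descending recursion of [iter_int], so that any two
    coordinates can be moved innermost. *)
Fixpoint iter_mean (l : seq nat) (g : (nat -> R) -> R) (x : nat -> R) : R :=
  if l is i :: l' then mean1 (fun t => iter_mean l' g (update x i t)) else g x.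

Lemma iter_mean_cat l l' g x : iter_mean (l ++ l') g x = iter_mean l (iter_mean l' g) x.
Proof.
elim: l x => [//|i l IH] x /=; congr mean1; apply/funext => t; exact: IH.
Qed.

Lemma nice_mean1 g i : nice g -> nice (fun x => mean1 (fun t => g (update x i t))).
Proof.
move=> ng; have [[C hC] mg] := ng; split.
  by exists C => x; apply: mean1_norm_le => //; exact: nice_update.
move=> d T h mh.
pose G (p : T * R) := g (fun j => if j == i then p.2 else h j p.1).
have bG : bounded_meas G.
  apply: (@nice_bounded_meas _ _ (fun j (p : T * R) => if j == i then p.2 else h j p.1)) => // j.
  case: (j == i); first exact: measurable_snd.
  by apply: (measurableT_comp (mh j)); exact: measurable_fst.
exact: (bounded_meas_mean1 bG).1.
Qed.

Lemma nice_iter_mean l g : nice g -> nice (iter_mean l g).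
Proof. by move=> ng; elim: l => [//|i l IH] /=; exact: nice_mean1. Qed.

Lemma iter_mean_norm_le l g C x : nice g -> (forall y, `|g y| <= C) ->
  `|iter_mean l g x| <= C.
Proof.
move=> ng hC; elim: l x => [//|i l IH] x /=.
apply: mean1_norm_le => [|t]; last exact: IH.
by apply: nice_update; exact: nice_iter_mean.
Qed.

Lemma iter_meanD l a b x : nice a -> nice b ->
  iter_mean l (fun y => a y + b y) x = iter_mean l a x + iter_mean l b x.
Proof.
move=> na nb; elim: l x => [//|i l IH] x /=.
rewrite -mean1D; [by congr mean1; apply/funext=> t; exact: IH|..].
- by apply: nice_update; exact: nice_iter_mean.
- by apply: nice_update; exact: nice_iter_mean.
Qed.

Lemma iter_meanZ l c a x : nice a ->
  iter_mean l (fun y => c * a y) x = c * iter_mean l a x.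
Proof.
move=> na; elim: l x => [//|i l IH] x /=.
rewrite -mean1Z; [by congr mean1; apply/funext=> t; exact: IH|..].
by apply: nice_update; exact: nice_iter_mean.
Qed.

Lemma iter_meanB l a b x : nice a -> nice b ->
  iter_mean l (fun y => a y - b y) x = iter_mean l a x - iter_mean l b x.
Proof.
move=> na nb; rewrite -mulN1r -iter_meanZ// -iter_meanD//; last exact: niceZ.
by congr iter_mean; apply/funext => y; rewrite mulN1r.
Qed.

Lemma iter_mean0 l x : iter_mean l (fun=> 0) x = 0.
Proof.
apply/eqP; rewrite -normr_le0; apply: iter_mean_norm_le; first exact: nice_cst.
by move=> y; rewrite normr0.
Qed.

Lemma iter_mean_sum (J : Type) (r : seq J) (h : J -> (nat -> R) -> R) l x :
  (forall i, nice (h i)) ->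
  iter_mean l (fun y => \sum_(i <- r) h i y) x = \sum_(i <- r) iter_mean l (h i) x.
Proof.
move=> nh; elim: r => [|i r IH].
  by under eq_fun do rewrite big_nil; rewrite big_nil iter_mean0.
under eq_fun do rewrite big_cons.
by rewrite big_cons iter_meanD ?IH//; exact: nice_sum.
Qed.

(** Only points whose integrated coordinates lie in [0,1] matter; this is what allows a graphon's
    averages to be replaced by their extension by zero inside a density. *)
Lemma eq_iter_mean l g g' x :
  (forall v, (forall i, i \in l -> I (v i)) -> (forall i, i \notin l -> v i = x i) -> g v = g' v) ->
  iter_mean l g x = iter_mean l g' x.
Proof.
elim: l g g' x => [|i l IH] g g' x gg' /=; first exact: gg'.
apply: eq_mean => t It; apply: IH => v vI vx; apply: gg' => j.
  rewrite inE; case: (boolP (j \in l)) => [/vI//|jl].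
  by rewrite orbF => /eqP ji; rewrite (vx _ jl) /update ji eqxx.
rewrite inE negb_or => /andP[ji jl].
by rewrite (vx _ jl) /update (negbTE ji).
Qed.

(** For distinct indices the two updates commute, and Fubini's theorem equates both orders with the
    double mean of [G]. *)
Lemma iter_mean_swap i j l g x : nice g ->
  iter_mean (i :: j :: l) g x = iter_mean (j :: i :: l) g x.
Proof.
move=> ng; have [->//|ij] := eqVneq i j.
pose G (p : R * R) := iter_mean l g (update (update x i p.1) j p.2).
have bG : bounded_meas G.
  apply: (@nice_bounded_meas _ _ (fun m (p : R * R) => update (update x i p.1) j p.2 m)).
    exact: nice_iter_mean.
  move=> m; rewrite /update; case: (m == j); first exact: measurable_snd.
  by case: (m == i); [exact: measurable_fst | exact: measurable_cst].
transitivity (mean2 G); first by rewrite mean2_fubini.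
rewrite (mean2_fubini_sym bG); congr mean1; apply/funext => t; congr mean1.
apply/funext => s; congr (iter_mean l g _); apply/funext => m; rewrite /update.
by case: eqVneq => [->|//]; rewrite (eq_sym j) (negbTE ij).
Qed.

(** [front] carries one index to the head by adjacent swaps, [swap] exchanges two blocks, and block
    exchanges generate all permutations. *)
Lemma iter_mean_perm l l' g x : nice g -> perm_eq l l' ->
  iter_mean l g x = iter_mean l' g x.
Proof.
move=> ng pll'.
have front i s1 s2 y : iter_mean (s1 ++ i :: s2) g y = iter_mean (i :: s1 ++ s2) g y.
  elim: s1 y => [//|j s1 IH] y.
  rewrite [RHS]iter_mean_swap// [LHS]/= [RHS]/=.
  by congr mean1; apply/funext => t; exact: IH.
have swap s1 s2 s3 y : iter_mean (s1 ++ s2 ++ s3) g y = iter_mean (s2 ++ s1 ++ s3) g y.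
  elim: s2 y => [//|i s2 IH] y; rewrite [LHS]front /=.
  by congr mean1; apply/funext => t; exact: IH.
by apply: (@catCA_perm_ind _ (fun s => iter_mean l g x = iter_mean s g x) _ l l' pll') => // s1 s2 s3 ->.
Qed.

(** [iter_int] integrates the variable of largest index outermost, whence the reversed list. The
    induction needs the coordinates from [k] on as a parameter [x]; the claim [K] then restores the
    default value 0 that [iter_int] gives them. *)
Lemma iter_intE k g : iter_int k g = iter_mean (rev (iota 0 k)) g (fun=> 0).
Proof.
suff H x : iter_int k (fun v => g (fun i => if (i < k)%N then v i else x i)) =
    iter_mean (rev (iota 0 k)) g x.
  rewrite -H; suff K k' (h h' : (nat -> R) -> R) : (forall v, (forall i, (k' <= i)%N -> v i = 0) -> h v = h' v) ->
      iter_int k' h = iter_int k' h'.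
    apply: K => v v0; congr g; apply/funext => i; case: ltnP => // ki; exact: v0.
  elim: k' h h' => [|m IH] h h' hh' /=; first exact: hh'.
  congr Rintegral; apply/funext => t; apply: IH => v v0; apply: hh' => i mi.
  by rewrite gtn_eqF// v0// ltnW.
elim: k x => [//|k IH] x.
rewrite -[in RHS]addn1 iotaD/= rev_cat/= add0n; congr Rintegral; apply/funext => t.
rewrite -IH; congr iter_int; apply/funext => v; congr g; apply/funext => i.
by rewrite /update ltnS leq_eqVlt; case: eqVneq => [->|//]; rewrite ltnn.
Qed.

End UnitSquare.

(** * Lengths of intervals and almost everywhere convergence *)

Section UnitSquareLimits.
Context {R : realType}.
Local Notation leb := (@lebesgue_measure R).
Local Notation I := (@I01 R).

(** The values of [f] are prescribed on [0,1[ only: at [u = 1] the half-open intervals of the code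
    no longer describe the bits, and that point is null. *)
Lemma mean1_co (a b : R) (f : R -> R) : bounded_meas f -> 0 <= a -> a <= b -> b <= 1 ->
  (forall u, 0 <= u -> u < 1 -> f u = (a <= u < b)%R%:R) -> mean1 f = b - a.
Proof.
move=> bf a0 ab b1 fE; rewrite /mean1 /I01 -Rintegral_itv_bndo_bndc; last first.
  apply: (@integrableS _ _ _ leb I); [exact: measurable_itv|exact: measurable_itv| |].
    by apply: subset_itv => //; rewrite bnd_simp.
  exact: (@bounded_meas_integrable _ _ _ leb I measurable_I01 lebesgue_I01 _ bf).
transitivity (Rintegral leb `[0, 1[ (\1_(`[a, b[%classic) : R -> R)).
  apply: eq_Rintegral => u; rewrite inE /= in_itv /= => /andP[u0 u1].
  by rewrite fE// mem_setE in_itv.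
rewrite /Rintegral integral_indic; [|exact: measurable_itv..].
rewrite (_ : _ `&` _ = `[a, b[%classic); last first.
  apply/setIidl => u /=; rewrite !in_itv /= => /andP[au ub].
  by rewrite (le_trans a0)//= (lt_le_trans ub).
have := lebesgue_measure_itv `[a, b[; rewrite /= lte_fin => abE.
transitivity (fine (if a < b then (b%:E - a%:E)%E else 0%E)); first by congr fine.
case: ltP => [//|ba]; by have -> : a = b by [apply/eqP; rewrite eq_le ab]; rewrite subrr.
Qed.

Lemma mean2_dominated_cvg (f_ : nat -> R * R -> R) (f : R * R -> R) C :
  (forall n, bounded_meas (f_ n)) -> bounded_meas f -> (forall n z, `|f_ n z| <= C) ->
  {ae (leb \x leb)%E, forall z, (I `*` I) z -> f_ n z @[n --> \oo] --> f z} ->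
  mean2 (f_ n) @[n --> \oo] --> mean2 f.
Proof.
move=> bf_ bf fC ff.
exact: (@mean_dominated_cvg _ _ _ (leb \x leb)%E (I `*` I) measurable_I01X lebesgue2_I01X _ _ C).
Qed.

(** The sum of the increments from [j0] on has integral at most [1 / 2 ^ j0], so it is finite almost
    everywhere, and there the telescoping series converges absolutely. The start [j0] is free
    because the kernel of index [r] is controlled only from stage [r] on. *)
Lemma ae_cvg_of_mean2_diff (f : nat -> R * R -> R) j0 :
  (forall n, bounded_meas (f n)) ->
  (forall n, (j0 <= n)%N -> mean2 (fun z => `|f n.+1 z - f n z|) <= 1 / (2 ^ n.+1)%:R) ->
  {ae (leb \x leb)%E, forall z, (I `*` I) z -> cvgn (f ^~ z)}.
Proof.
move=> bf small.
pose g n z := `|f (n + j0).+1 z - f (n + j0)%N z|.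
have bg n : bounded_meas (g n) by apply: bounded_meas_norm; exact: bounded_measB.
pose G z := (\sum_(0 <= n <oo) (g n z)%:E)%E.
have mg n : measurable_fun (I `*` I) (fun z => (g n z)%:E).
  by apply/measurable_EFinP; apply: measurable_funTS; exact: (bg n).1.
have g0 n z : (I `*` I) z -> (0 <= (g n z)%:E)%E by rewrite lee_fin normr_ge0.
have intG : (\int[(leb \x leb)%E]_(z in I `*` I) G z < +oo)%E.
  rewrite integral_nneseries//; last exact: measurable_I01X.
  have ig n : (\int[(leb \x leb)%E]_(z in I `*` I) (g n z)%:E = (mean2 (g n))%:E)%E.
    rewrite /mean2 /Rintegral fineK//; apply: integrable_fin_num.
      exact: measurable_I01X.
    exact: (@bounded_meas_integrable _ _ _ (leb \x leb)%E _ measurable_I01X lebesgue2_I01X _ (bg n)).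
  under eq_eseriesr do rewrite ig.
  have := @cvg_geometric_eseries_half R 1 j0 => /cvg_lim geo.
  apply: (@le_lt_trans _ _ (1 / 2 ^+ j0)%:E); last exact: ltry.
  rewrite -[leRHS]geo; last exact: ereal_hausdorff.
  apply: lee_nneseries => [n _ _|n _]; rewrite lee_fin.
    by apply: mean2_ge0 => z; exact: normr_ge0.
  by rewrite addnS; apply: small; rewrite leq_addl.
have iG : (leb \x leb)%E.-integrable (I `*` I) G.
  apply/integrableP; split.
    rewrite /G; apply: (ge0_emeasurable_sum (P := xpredT)) => k; last by move=> _; exact: mg.
    by move=> z zI _; exact: g0.
  apply: le_lt_trans intG; rewrite le_eqVlt; apply/orP; left; apply/eqP.
  apply: eq_integral => z; rewrite inE => zI.
  by rewrite gee0_abs// /G nneseries_ge0// => n _ _; exact: g0.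
have := @integrable_ae _ _ _ (leb \x leb)%E _ measurable_I01X _ iG; apply: filterS => z fin zI.
have {}fin := fin zI.
have cg : cvgn (series (g ^~ z)).
  apply: nnseries_is_cvg; first by move=> n; exact: normr_ge0.
  by move: fin; rewrite fin_numE -/(G z) => /andP[_]; rewrite -ltey.
have cd : cvgn (series (fun n => f (n + j0).+1 z - f (n + j0)%N z)).
  exact: normed_cvg.
have /cvg_ex[l cl] : cvgn (fun n => f (n + j0)%N z).
  rewrite (_ : (fun _ => _) = fun n => f j0 z + series (telescope (fun m => f (m + j0)%N z)) n).
    by apply: is_cvgD; [exact: is_cvg_cst | exact: cd].
  by apply/funext => n; rewrite [LHS](eq_sum_telescope (fun m => f (m + j0)%N z)) add0n.
by apply/cvg_ex; exists l; rewrite -(cvg_shiftn j0).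
Qed.

End UnitSquareLimits.

(** * Almost everywhere bounds, null sets and the uniform law *)

Section AlmostEverywhere.
Context {R : realType}.
Local Notation leb := (@lebesgue_measure R).
Local Notation I := (@I01 R).

Lemma mean1_ae_le (h : R -> R) e : bounded_meas h -> 0 <= e ->
  {ae leb, forall t, I t -> `|h t| <= e} -> `|mean1 h| <= e.
Proof.
move=> bh e0 he; have bn := bounded_meas_norm bh.
apply: le_trans (@ler_norm_mean _ _ _ leb I measurable_I01 lebesgue_I01 _ bh) _.
rewrite /Rintegral -lee_fin fineK; last first.
  apply: integrable_fin_num; first exact: measurable_I01.
  exact: (@bounded_meas_integrable _ _ _ leb I measurable_I01 lebesgue_I01 _ bn).
apply: (@le_trans _ _ (\int[leb]_(x in I) e%:E)%E).
  apply: ae_ge0_le_integral => //; first exact: measurable_I01.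
  - by apply/measurable_EFinP; apply: measurable_funTS; exact: bn.1.
rewrite integral_cst; last exact: measurable_I01.
rewrite -[leRHS]mule1; apply: lee_wpmul2l => //.
by rewrite le_eqVlt; apply/orP; left; apply/eqP; exact: lebesgue_I01.
Qed.

Lemma mean2_ae_le (h : R * R -> R) e : bounded_meas h -> 0 <= e ->
  {ae (leb \x leb)%E, forall z, (I `*` I) z -> `|h z| <= e} -> mean2 (fun z => `|h z|) <= e.
Proof.
move=> bh e0 he; have bn := bounded_meas_norm bh.
rewrite /mean2 /Rintegral -lee_fin fineK; last first.
  apply: integrable_fin_num; first exact: measurable_I01X.
  exact: (@bounded_meas_integrable _ _ _ (leb \x leb)%E _ measurable_I01X lebesgue2_I01X _ bn).
apply: (@le_trans _ _ (\int[(leb \x leb)%E]_(x in I `*` I) e%:E)%E).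
  apply: ae_ge0_le_integral => //; first exact: measurable_I01X.
  - by apply/measurable_EFinP; apply: measurable_funTS; exact: bn.1.
rewrite integral_cst; last exact: measurable_I01X.
rewrite -[leRHS]mule1; apply: lee_wpmul2l => //.
by rewrite le_eqVlt; apply/orP; left; apply/eqP; exact: lebesgue2_I01X.
Qed.

Lemma ae_notin_mean1 (A : set R) : measurable A -> mean1 (\1_A) = 0 ->
  {ae leb, forall t, I t -> ~ A t}.
Proof.
move=> mA A0; have mAI : measurable (A `&` I) by apply: measurableI => //; exact: measurable_I01.
exists (A `&` I); split => //; last first.
  by move=> t /= /not_implyP[It /contrapT At].
have h : fine (leb (A `&` I)) = 0.
  by rewrite -A0 /mean1 /Rintegral integral_indic//; exact: measurable_I01.
rewrite -[LHS]fineK ?h//.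
rewrite ge0_fin_numE//; apply: (@le_lt_trans _ _ (leb I)); last first.
  by rewrite [X in (X < _)%E]lebesgue_I01 ltry.
apply: le_measure; rewrite ?inE//; exact: measurable_I01.
Qed.

Definition unif : probability (measurableTypeR R) R := uniform_prob (@ltr01 R).

Lemma integral_unif_ge0 (f : R -> R) : bounded_meas f -> (forall x, 0 <= f x) ->
  (\int[unif]_x (f x)%:E)%E = (mean1 f)%:E.
Proof.
move=> bf f0; rewrite integral_uniform; last 2 first.
- by apply/measurable_EFinP; exact: bf.1.
- by move=> x; rewrite lee_fin.
rewrite subr0 invr1 mul1e /mean1 /Rintegral fineK//.
apply: integrable_fin_num; first exact: measurable_I01.
exact: (@bounded_meas_integrable _ _ _ (@lebesgue_measure R) (@I01 R) measurable_I01 lebesgue_I01 _ bf).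
Qed.

End AlmostEverywhere.

(** * Homomorphism densities and the counting lemma *)

Section Homomorphism.
Context {R : realType}.

Definition unit_valued (T : Type) (f : T -> R) := forall x, 0 <= f x <= 1.

Definition kernel (w : R * R -> R) := bounded_meas w /\ unit_valued w.

Definition edges (k : nat) : seq ('I_k * 'I_k) :=
  [seq p : 'I_k * 'I_k <- index_enum _ | (p.1 < p.2)%N].

(** Each edge carries its own kernel, as in a decorated graph. The family is indexed by all pairs,
    of which only those in [edges k] enter. *)
Definition hom_integrand k (w : 'I_k * 'I_k -> R * R -> R) (x : nat -> R) : R :=
  \prod_(p <- edges k) w p (x p.1, x p.2).

Definition hom k (w : 'I_k * 'I_k -> R * R -> R) : R :=
  iter_mean (rev (iota 0 k)) (hom_integrand w) (fun=> 0).

Lemma nice_hom_integrand k (w : 'I_k * 'I_k -> R * R -> R) : (forall p, bounded_meas (w p)) -> nice (hom_integrand w).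
Proof. by move=> bw; apply: nice_prod => p; apply: nice_kernel. Qed.

(* The cut norm is tested against [0,1]-valued functions rather than sets, which
   is what appears when all variables but two are frozen in a density. *)
Definition cut_le (w : R * R -> R) (e : R) := forall a b : R -> R,
  bounded_meas a -> bounded_meas b -> unit_valued a -> unit_valued b ->
  `|mean2 (fun z => w z * (a z.1 * b z.2))| <= e.

Lemma mem_edges k p : (p \in edges k) = (p.1 < p.2)%N.
Proof. by rewrite mem_filter mem_index_enum andbT. Qed.

Lemma edges_uniq k : uniq (edges k).
Proof. by rewrite filter_uniq// index_enum_uniq. Qed.

Lemma unit_valued_prod (T J : Type) (r : seq J) (Q : pred J) (h : J -> T -> R) :
  (forall i, unit_valued (h i)) -> unit_valued (fun x => \prod_(i <- r | Q i) h i x).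
Proof.
move=> hh x; apply: (big_ind (fun y : R => 0 <= y <= 1)).
- by rewrite ler01 lexx.
- by move=> a b /andP[a0 a1] /andP[b0 b1]; rewrite mulr_ge0//= mulr_ile1.
- by move=> i _; exact: hh.
Qed.

(** The coordinates [i] and [j] are integrated innermost. Once the others are frozen, [a] depends on
    the coordinate [i] alone and [b] on [j] alone, so the cut norm bounds each inner double mean. *)
Lemma iter_mean_cut_le (l : seq nat) i j (w : R * R -> R) a b x e :
  i != j -> i \in l -> j \in l -> bounded_meas w -> cut_le w e ->
  nice a -> nice b -> unit_valued a -> unit_valued b ->
  (forall y t, a (update y j t) = a y) -> (forall y t, b (update y i t) = b y) ->
  `|iter_mean l (fun y => w (y i, y j) * (a y * b y)) x| <= e.
Proof.
move=> ij il jl bw we na nb ua ub aj bi.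
have nG : nice (fun y => w (y i, y j) * (a y * b y)).
  by apply: niceM; [exact: nice_kernel | exact: niceM].
have pl : perm_eq l (rem j (rem i l) ++ [:: i; j]).
  have jl' : j \in rem i l.
    by move: jl; rewrite (perm_mem (perm_to_rem il)) inE eq_sym (negbTE ij).
  rewrite perm_sym perm_catC /= perm_sym (permPl (perm_to_rem il)) perm_cons.
  exact: perm_to_rem.
rewrite (iter_mean_perm _ nG pl) iter_mean_cat.
apply: iter_mean_norm_le; first exact: nice_iter_mean.
move=> y.
have bw' : bounded_meas (fun z : R * R => w z * (a (update y i z.1) * b (update y j z.2))).
  apply: bounded_measM => //; apply: bounded_measM.
    exact: (bounded_meas_comp (nice_update y i na) (@measurable_fst _ _ _ _)).
  exact: (bounded_meas_comp (nice_update y j nb) (@measurable_snd _ _ _ _)).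
have -> : iter_mean [:: i; j] (fun y => w (y i, y j) * (a y * b y)) y =
    mean2 (fun z => w z * (a (update y i z.1) * b (update y j z.2))).
  rewrite (mean2_fubini bw'); congr mean1; apply/funext => s; congr mean1; apply/funext => t.
  rewrite /= aj; congr (w (_, _) * (_ * _)); rewrite /update ?eqxx ?(negbTE ij)//.
  rewrite -[in RHS](bi _ s); congr b; apply/funext => m; rewrite /update.
  by case: (eqVneq m j) => // ->; rewrite eq_sym (negbTE ij).
apply: (we (fun s => a (update y i s)) (fun t => b (update y j t))); [exact: nice_update|exact: nice_update|by move=> s; exact: ua|by move=> s; exact: ub].
Qed.

(** The kernels are exchanged one edge at a time: edges in [es1] already carry [w'], those in [es2]
    still carry [w]. Each exchange costs at most [e], since the other edges form a product of a
    function not involving [p.2] and one not involving [p.1]. *)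
Lemma hom_cut_le k (w w' : 'I_k * 'I_k -> R * R -> R) e :
  (forall p, kernel (w p)) -> (forall p, kernel (w' p)) ->
  (forall p, cut_le (fun z => w p z - w' p z) e) ->
  `|hom w - hom w'| <= (size (edges k))%:R * e.
Proof.
move=> kw kw' we.
pose V es (v : 'I_k * 'I_k -> R * R -> R) (x : nat -> R) := \prod_(p <- es) v p (x p.1, x p.2).
have nV es v : (forall p, kernel (v p)) -> nice (V es v).
  by move=> kv; apply: nice_prod => p; apply: nice_kernel; exact: (kv p).1.
have uV es v : (forall p, kernel (v p)) -> unit_valued (V es v).
  by move=> kv; apply: unit_valued_prod => p x; exact: (kv p).2.
pose t es1 es2 := iter_mean (rev (iota 0 k)) (fun x => V es1 w' x * V es2 w x) (fun=> 0).
suff H es2 es1 : es1 ++ es2 = edges k -> `|t es1 es2 - t (edges k) [::]| <= (size es2)%:R * e.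
  have := H (edges k) [::] erefl.
  rewrite (_ : t [::] _ = hom w); last first.
    by congr iter_mean; apply/funext => x; rewrite /V big_nil mul1r.
  rewrite (_ : t _ [::] = hom w')//.
  by congr iter_mean; apply/funext => x; rewrite /V big_nil mulr1.
elim: es2 es1 => [|p es2 IH] es1; first by rewrite cats0 => ->; rewrite subrr normr0 mul0r.
move=> es12; rewrite -(subrK (t (rcons es1 p) es2) (t es1 _)) -addrA.
apply: le_trans (ler_normD _ _) _; rewrite mulrS mulrDl mul1r lerD//; last first.
  by apply: IH; rewrite cat_rcons.
rewrite /t -iter_meanB; [|by apply: niceM; exact: nV..].
have pE : p \in edges k by rewrite -es12 mem_cat inE eqxx orbT.
have p12 : (p.1 < p.2)%N by rewrite -mem_edges.
(* Edges avoiding [p.2] go into [a], those meeting [p.2] into [b]. *)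
pose far (q : 'I_k * 'I_k) := (p.2 != q.1) && (p.2 != q.2).
pose a (x : nat -> R) := (\prod_(q <- es1 | far q) w' q (x q.1, x q.2)) *
            \prod_(q <- es2 | far q) w q (x q.1, x q.2).
pose b (x : nat -> R) := (\prod_(q <- es1 | ~~ far q) w' q (x q.1, x q.2)) *
            \prod_(q <- es2 | ~~ far q) w q (x q.1, x q.2).
have -> : (fun y => V es1 w' y * V (p :: es2) w y - V (rcons es1 p) w' y * V es2 w y) =
    fun y => (w p (y p.1, y p.2) - w' p (y p.1, y p.2)) * (a y * b y).
  apply/funext => y; rewrite /V -cats1 big_cat big_cons big_seq1 /=.
  have -> : a y * b y = (\prod_(q <- es1) w' q (y q.1, y q.2)) * \prod_(q <- es2) w q (y q.1, y q.2).
    by rewrite [in RHS](bigID far) [X in _ = _ * X](bigID far) /= /a /b; ring.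
  by ring.
apply: (@iter_mean_cut_le _ _ _ (fun z => w p z - w' p z)).
- by rewrite neq_ltn p12.
- by rewrite mem_rev mem_iota /=.
- by rewrite mem_rev mem_iota /=.
- by apply: bounded_measB; [exact: (kw p).1 | exact: (kw' p).1].
- exact: we.
- by apply: niceM; apply: nice_prod => q; apply: nice_kernel; [exact: (kw' q).1|exact: (kw q).1].
- by apply: niceM; apply: nice_prod => q; apply: nice_kernel; [exact: (kw' q).1|exact: (kw q).1].
- move=> x; apply/andP; have /andP[A0 A1] := unit_valued_prod es1 far (fun q (x : nat -> R) => (kw' q).2 (x q.1, x q.2)) x.
  have /andP[B0 B1] := unit_valued_prod es2 far (fun q (x : nat -> R) => (kw q).2 (x q.1, x q.2)) x.
  by split; [exact: mulr_ge0 | exact: mulr_ile1].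
- move=> x; apply/andP; have /andP[A0 A1] := unit_valued_prod es1 (predC far) (fun q (x : nat -> R) => (kw' q).2 (x q.1, x q.2)) x.
  have /andP[B0 B1] := unit_valued_prod es2 (predC far) (fun q (x : nat -> R) => (kw q).2 (x q.1, x q.2)) x.
  by split; [exact: mulr_ge0 | exact: mulr_ile1].
- move=> y s; congr (_ * _); apply: eq_bigr => q /andP[q1 q2];
    by rewrite /update !(inj_eq val_inj) eq_sym (negbTE q1) eq_sym (negbTE q2).
(* An edge other than [p] that meets [p.2] misses [p.1]: [p] occurs once in [edges k], and the
   endpoints of an edge are ordered. *)
- have near q : q \in es1 ++ es2 -> ~~ far q -> (q.1 != p.1) && (q.2 != p.1).
    move=> qes; have pq : q != p.
      apply: contraTneq qes => ->.
      have := edges_uniq k; rewrite -es12 uniq_catC /= => /andP[+ _].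
      by rewrite mem_cat orbC mem_cat.
    have : (q.1 < q.2)%N.
      rewrite -mem_edges -es12; move: qes; rewrite !mem_cat inE => /orP[->//|->].
      by rewrite !orbT.
    rewrite negb_and !negbK -!(inj_eq val_inj) => q12 /orP[/eqP pq1|/eqP pq2].
      by rewrite -pq1 !neq_ltn p12 (ltn_trans p12)// ?orbT// pq1.
    rewrite -pq2 (neq_ltn p.2) p12 orbT andbT; apply: contra_neq pq => pq1.
    by apply/eqP; rewrite -pair_eqE /= -!(inj_eq val_inj) pq1 pq2 !eqxx.
  move=> y s; congr (_ * _); rewrite big_seq_cond [RHS]big_seq_cond;
    apply: eq_bigr => q /andP[qe qf].
  - have /andP[/negbTE h1 /negbTE h2] : (q.1 != p.1) && (q.2 != p.1).
      by apply: near; rewrite // mem_cat qe.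
    by rewrite /update !(inj_eq val_inj) h1 h2.
  - have /andP[/negbTE h1 /negbTE h2] : (q.1 != p.1) && (q.2 != p.1).
      by apply: near; rewrite // mem_cat qe orbT.
    by rewrite /update !(inj_eq val_inj) h1 h2.
Qed.

End Homomorphism.

(** * Averages over finite partitions *)

Opaque mean1 mean2.

Section FinitePartition.
Context {R : realType}.

Section one.
Context (T : finType) (phi : R -> T).

(** A finite measurable partition is given as a labelling [phi] by a finite type, whose level sets
    are the atoms. *)
Definition measurable_levels := forall s, measurable [set x | phi x = s].

Definition level_indic s (x : R) : R := (phi x == s)%:R.

Definition level_mass s := mean1 (level_indic s).

Definition step (c : T -> T -> R) (z : R * R) := c (phi z.1) (phi z.2).

Hypothesis mphi : measurable_levels.

Lemma bounded_meas_level_indic s : bounded_meas (level_indic s).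
Proof.
rewrite (_ : level_indic s = \1_[set x | phi x = s]).
  by apply: bounded_meas_indic; exact: mphi.
apply/funext => x; rewrite indicE /level_indic; congr (_%:R); congr nat_of_bool.
by apply/eqP/idP; rewrite inE.
Qed.

Lemma level_expand (h : T -> R) x : h (phi x) = \sum_s h s * level_indic s x.
Proof.
rewrite (bigD1 (phi x))//= /level_indic eqxx mulr1 big1 ?addr0// => s sx.
by rewrite eq_sym (negbTE sx) mulr0.
Qed.

Lemma bounded_meas_level (h : T -> R) : bounded_meas (fun x => h (phi x)).
Proof.
under eq_fun do rewrite level_expand; apply: bounded_meas_sum => s.
by apply: bounded_measZ; exact: bounded_meas_level_indic.
Qed.

Lemma mean1_level (h : T -> R) :
  mean1 (fun x => h (phi x)) = \sum_s level_mass s * h s.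
Proof.
under eq_fun do rewrite level_expand.
rewrite mean1_sum => [|s]; last by apply: bounded_measZ; exact: bounded_meas_level_indic.
apply: eq_bigr => s _; rewrite mean1Z; first exact: mulrC.
exact: bounded_meas_level_indic.
Qed.

Lemma level_mass_ge0 s : 0 <= level_mass s.
Proof. by apply: mean1_ge0 => x; rewrite /level_indic ler0n. Qed.

Definition box_indic s t (z : R * R) : R := level_indic s z.1 * level_indic t z.2.

Lemma bounded_meas_box s t : bounded_meas (box_indic s t).
Proof.
apply: bounded_measM.
  exact: (bounded_meas_comp (bounded_meas_level_indic s) (@measurable_fst _ _ _ _)).
exact: (bounded_meas_comp (bounded_meas_level_indic t) (@measurable_snd _ _ _ _)).
Qed.

Lemma box_indic01 s t z : 0 <= box_indic s t z <= 1.
Proof.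
rewrite /box_indic /level_indic.
by case: (_ == s); case: (_ == t); rewrite ?mulr1 ?mulr0 ?lexx ?ler01.
Qed.

Lemma step_expand c z : step c z = \sum_s \sum_t c s t * box_indic s t z.
Proof.
rewrite /step (level_expand (fun s => c s _)); apply: eq_bigr => s _.
rewrite (level_expand (c s)) big_distrl; apply: eq_bigr => t _ /=.
by rewrite /box_indic; ring.
Qed.

Lemma bounded_meas_step c : bounded_meas (step c).
Proof.
rewrite (_ : step c = fun z => \sum_s \sum_t c s t * box_indic s t z); last first.
  by apply/funext => z; exact: step_expand.
do 2 apply: bounded_meas_sum => ?.
by apply: bounded_measZ; exact: bounded_meas_box.
Qed.

Lemma mean2_box s t : mean2 (box_indic s t) = level_mass s * level_mass t.
Proof.
rewrite (mean2_fubini (bounded_meas_box s t)) /box_indic /=.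
transitivity (mean1 (fun x => level_mass t * level_indic s x)).
  congr mean1; apply/funext => x; rewrite mean1Z; last exact: bounded_meas_level_indic.
  exact: mulrC.
rewrite mean1Z; first exact: mulrC.
exact: bounded_meas_level_indic.
Qed.

Lemma mean2_mul_step (w : R * R -> R) c : bounded_meas w ->
  mean2 (fun z => w z * step c z) =
  \sum_s \sum_t c s t * mean2 (fun z => w z * box_indic s t z).
Proof.
move=> bw; have bwb s t : bounded_meas (fun z => w z * box_indic s t z).
  by apply: bounded_measM => //; exact: bounded_meas_box.
transitivity (mean2 (fun z => \sum_s \sum_t c s t * (w z * box_indic s t z))).
  congr mean2; apply/funext => z; rewrite step_expand big_distrr; apply: eq_bigr => s _ /=.
  by rewrite big_distrr; apply: eq_bigr => t _ /=; rewrite mulrCA.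
rewrite mean2_sum; last by move=> s; apply: bounded_meas_sum => t; exact: bounded_measZ.
apply: eq_bigr => s _; rewrite mean2_sum; last by move=> t; exact: bounded_measZ.
by apply: eq_bigr => t _; rewrite mean2Z.
Qed.

Lemma mean2_step c : mean2 (step c) = \sum_s \sum_t c s t * (level_mass s * level_mass t).
Proof.
transitivity (mean2 (fun z => 1 * step c z)); first by under eq_fun do rewrite mul1r.
rewrite mean2_mul_step; last exact: bounded_meas_cst.
do 2 apply: eq_bigr => ? _; rewrite -mean2_box; congr (_ * mean2 _).
by apply/funext => z; rewrite mul1r.
Qed.

(* On boxes of measure zero the value [w (0, 0)] makes [cond_coef] linear in
   [w], and equal to 1 when [w] is 1 on the unit square. *)
Definition cond_coef (w : R * R -> R) s t :=
  if level_mass s * level_mass t == 0 then w (0, 0)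
  else mean2 (fun z => w z * box_indic s t z) / (level_mass s * level_mass t).

Definition cond (w : R * R -> R) := step (cond_coef w).

Definition energy (w : R * R -> R) := mean2 (fun z => cond w z ^+ 2).

Section kernel.
Variable w : R * R -> R.
Hypothesis kw : kernel w.

Lemma mean2_kernel_box s t :
  0 <= mean2 (fun z => w z * box_indic s t z) <= level_mass s * level_mass t.
Proof.
have [bw uw] := kw; have bwb : bounded_meas (fun z => w z * box_indic s t z).
  by apply: bounded_measM => //; exact: bounded_meas_box.
apply/andP; split.
  apply: mean2_ge0 => z; have /andP[w0 _] := uw z; have /andP[b0 _] := box_indic01 s t z.
  exact: mulr_ge0.
rewrite -mean2_box; apply: (le_mean2 bwb (bounded_meas_box s t)) => z.
have /andP[_ w1] := uw z; have /andP[b0 _] := box_indic01 s t z.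
by rewrite -[leRHS]mul1r ler_wpM2r.
Qed.

Lemma cond_coef01 s t : 0 <= cond_coef w s t <= 1.
Proof.
rewrite /cond_coef; case: ifPn => [_|pp0]; first exact: kw.2.
have pp : 0 < level_mass s * level_mass t.
  by rewrite lt_def pp0 mulr_ge0// level_mass_ge0.
have /andP[m0 m1] := mean2_kernel_box s t.
by apply/andP; split; [rewrite divr_ge0// ltW | rewrite ler_pdivrMr// mul1r].
Qed.

Lemma kernel_cond : kernel (cond w).
Proof. by split; [exact: bounded_meas_step | move=> z; exact: cond_coef01]. Qed.

(** On a null box both sides vanish, the right one by [mean2_kernel_box], so the default in
    [cond_coef] never shows in an integral. *)
Lemma cond_coef_mass s t :
  cond_coef w s t * (level_mass s * level_mass t) =
  mean2 (fun z => w z * box_indic s t z).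
Proof.
rewrite /cond_coef; case: ifPn => [/eqP pp|pp]; last by rewrite divfK.
by have := mean2_kernel_box s t; rewrite pp -eq_le => /eqP; rewrite mulr0 => ->.
Qed.

(** The integrals over every box agree, which makes [cond w] the orthogonal projection of [w] onto
    the step functions in L2. *)
Lemma mean2_cond c :
  mean2 (fun z => w z * step c z) = mean2 (fun z => cond w z * step c z).
Proof.
rewrite mean2_mul_step; last exact: kw.1.
rewrite [RHS](mean2_step (fun s t => cond_coef w s t * c s t)).
by do 2 apply: eq_bigr => ? _; rewrite -cond_coef_mass; ring.
Qed.

Lemma energy01 : 0 <= energy w <= 1.
Proof.
have [bc uc] := kernel_cond.
have bc2 : bounded_meas (fun z => cond w z ^+ 2) by exact: bounded_measM.
apply/andP; split; first by apply: mean2_ge0 => z; exact: sqr_ge0.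
rewrite -[leRHS](mean2_cst (1 : R)); apply: (le_mean2 bc2 (bounded_meas_cst _ 1)) => z.
by have /andP[c0 c1] := uc z; rewrite expr_le1.
Qed.

End kernel.

Lemma cond_coefD w w0 w1 : bounded_meas w0 -> bounded_meas w1 ->
  (forall z, w z = w0 z + w1 z) ->
  forall s t, cond_coef w s t = cond_coef w0 s t + cond_coef w1 s t.
Proof.
move=> b0 b1 ww s t; have -> : w = (fun z => w0 z + w1 z) by exact/funext.
rewrite /cond_coef; case: ifPn => // _; rewrite -mulrDl; congr (_ / _).
rewrite -mean2D; [|by apply: bounded_measM => //; exact: bounded_meas_box..].
by congr mean2; apply/funext => z; rewrite mulrDl.
Qed.

Lemma cond_coef1 w : (forall z, (@I01 R `*` @I01 R) z -> w z = 1) ->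
  forall s t, cond_coef w s t = 1.
Proof.
move=> w1 s t; rewrite /cond_coef; case: ifPn => [_|pp].
  by apply: w1; split; rewrite /I01/= in_itv/= lexx ler01.
rewrite -(divff pp) -mean2_box; congr (_ / _).
by apply: eq_mean2 => z /w1 ->; rewrite mul1r.
Qed.

Lemma cond_coef_sym w : bounded_meas w -> (forall x y, w (x, y) = w (y, x)) ->
  forall s t, cond_coef w s t = cond_coef w t s.
Proof.
move=> bw ww s t; rewrite /cond_coef mulrC; case: ifPn => // _; congr (_ / _).
have bwb s' t' : bounded_meas (fun z => w z * box_indic s' t' z).
  by apply: bounded_measM => //; exact: bounded_meas_box.
rewrite (mean2_fubini (bwb s t)) (mean2_fubini_sym (bwb t s)).
congr mean1; apply/funext => x; congr mean1; apply/funext => y /=.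
by rewrite ww /box_indic /= [level_indic s _ * _]mulrC.
Qed.

End one.

Section refinement.
Context (T S : finType) (phi : R -> T) (psi : R -> S) (g : S -> T) (w : R * R -> R).
Hypotheses (mphi : measurable_levels phi) (mpsi : measurable_levels psi).
Hypotheses (gpsi : forall x, phi x = g (psi x)) (kw : kernel w).

Lemma step_refine c : step phi c = step psi (fun s t => c (g s) (g t)).
Proof. by apply/funext => z; rewrite /step !gpsi. Qed.

(** Pythagoras: [cond phi w] is also a step function for [psi], so projecting twice shows that the
    cross term equals the coarse energy. *)
Lemma energy_refine :
  mean2 (fun z => (cond psi w z - cond phi w z) ^+ 2) = energy psi w - energy phi w.
Proof.
have [bp up] := kernel_cond mphi kw; have [bs us] := kernel_cond mpsi kw.
have cross : mean2 (fun z => cond psi w z * cond phi w z) = energy phi w.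
  rewrite [cond phi w]step_refine -(mean2_cond mpsi kw) -step_refine.
  exact: (mean2_cond mphi kw).
have bps : bounded_meas (fun z => cond psi w z * cond phi w z) by exact: bounded_measM.
have bp2 : bounded_meas (fun z => cond phi w z ^+ 2) by exact: bounded_measM.
have bs2 : bounded_meas (fun z => cond psi w z ^+ 2) by exact: bounded_measM.
transitivity (mean2 (fun z => cond psi w z ^+ 2 + cond phi w z ^+ 2 +
    -2 * (cond psi w z * cond phi w z))).
  by congr mean2; apply/funext => z; ring.
rewrite (mean2D (bounded_measD bs2 bp2) (bounded_measZ _ bps)) (mean2D bs2 bp2).
rewrite (mean2Z _ bps) cross /energy; move: (mean2 _) (mean2 _) => a b; ring.
Qed.

Lemma energy_le_refine : energy phi w <= energy psi w.
Proof. by rewrite -subr_ge0 -energy_refine; apply: mean2_ge0 => z; exact: sqr_ge0. Qed.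

(* Testing [w - cond phi w] against a [psi]-measurable function amounts to testing
   [cond psi w - cond phi w], whose L2 norm is the energy increment. *)
Lemma sqr_mean2_refine_le (c : S -> S -> R) : (forall s t, `|c s t| <= 1) ->
  mean2 (fun z => (w z - cond phi w z) * step psi c z) ^+ 2 <= energy psi w - energy phi w.
Proof.
move=> c1; have [bp up] := kernel_cond mphi kw; have [bs us] := kernel_cond mpsi kw.
have bc := bounded_meas_step mpsi c; have [bw uw] := kw.
have -> : mean2 (fun z => (w z - cond phi w z) * step psi c z) =
    mean2 (fun z => (cond psi w z - cond phi w z) * step psi c z).
  transitivity (mean2 (fun z => w z * step psi c z - cond phi w z * step psi c z)).
    by congr mean2; apply/funext => z; ring.
  rewrite mean2B; [|exact: bounded_measM..].
  rewrite (mean2_cond mpsi kw) -mean2B; [|exact: bounded_measM..].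
  by congr mean2; apply/funext => z; ring.
have bd : bounded_meas (fun z => cond psi w z - cond phi w z) by exact: bounded_measB.
apply: le_trans (sqr_mean2_le (bounded_measM bd bc)) _.
rewrite -energy_refine.
apply: le_mean2; [by do 2 apply: bounded_measM|exact: bounded_measM|move=> z].
rewrite exprMn -[leRHS]mulr1 ler_wpM2l ?sqr_ge0//.
rewrite -real_normK ?num_real// expr_le1//; exact: c1.
Qed.

End refinement.

Lemma cvg_sum_seq (F : set_system nat) (FF : Filter F) (J : Type) (r : seq J)
    (Q : pred J) (f : J -> nat -> R) (l : J -> R) :
  (forall j, f j n @[n --> F] --> l j) ->
  \sum_(j <- r | Q j) f j n @[n --> F] --> \sum_(j <- r | Q j) l j.
Proof.
move=> fl; elim: r => [|j r IH].
  by under eq_fun do rewrite big_nil; rewrite big_nil; exact: cvg_cst.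
under eq_fun do rewrite big_cons; rewrite big_cons; case: (Q j) => //.
exact: cvgD.
Qed.

Lemma cvg_prod_seq (F : set_system nat) (FF : Filter F) (J : Type) (r : seq J)
    (Q : pred J) (f : J -> nat -> R) (l : J -> R) :
  (forall j, f j n @[n --> F] --> l j) ->
  \prod_(j <- r | Q j) f j n @[n --> F] --> \prod_(j <- r | Q j) l j.
Proof.
move=> fl; elim: r => [|j r IH].
  by under eq_fun do rewrite big_nil; rewrite big_nil; exact: cvg_cst.
under eq_fun do rewrite big_cons; rewrite big_cons; case: (Q j) => //.
exact: cvgM.
Qed.

Section finite_iteration.
Context (T : finType).

Definition update_level (x : nat -> T) (i : nat) (s : T) : nat -> T :=
  fun j => if j == i then s else x j.

Fixpoint iter_sum (l : seq nat) (p : T -> R) (h : (nat -> T) -> R) (x : nat -> T) : R :=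
  if l is i :: l' then \sum_s p s * iter_sum l' p h (update_level x i s) else h x.

Lemma iter_mean_level (phi : R -> T) l h x : measurable_levels phi ->
  iter_mean l (fun y => h (phi \o y)) x = iter_sum l (level_mass phi) h (phi \o x).
Proof.
move=> mphi; elim: l x => [//|i l IH] x /=.
rewrite -(mean1_level mphi (fun s => iter_sum l (level_mass phi) h (update_level (phi \o x) i s))).
congr mean1; apply/funext => t; rewrite IH; congr (iter_sum l _ _ _).
by apply/funext => j; rewrite /= /update /update_level; case: ifP.
Qed.

Lemma eq_iter_sum l p h x y :
  (forall v v', (forall i, i \notin l -> v i = x i) -> (forall i, i \notin l -> v' i = y i) ->
    (forall i, i \in l -> v i = v' i) -> h v = h v') ->
  iter_sum l p h x = iter_sum l p h y.
Proof.
elim: l x y => [|i l IH] x y hl /=; first exact: hl.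
apply: eq_bigr => s _; congr (_ * _); apply: IH => v v' vx vy vv; apply: hl => j.
- by rewrite inE negb_or => /andP[ji jl]; rewrite vx// /update_level (negbTE ji).
- by rewrite inE negb_or => /andP[ji jl]; rewrite vy// /update_level (negbTE ji).
- rewrite inE; case: (boolP (j \in l)) => [/vv//|jl]; rewrite orbF => /eqP ji.
  by rewrite vx// vy// /update_level ji eqxx.
Qed.

Lemma iter_sum_cvg (F : set_system nat) (FF : Filter F) l
    (p_ : nat -> T -> R) p (h_ : nat -> (nat -> T) -> R) h x :
  (forall s, p_ n s @[n --> F] --> p s) -> (forall y, h_ n y @[n --> F] --> h y) ->
  iter_sum l (p_ n) (h_ n) x @[n --> F] --> iter_sum l p h x.
Proof.
move=> pc hc; elim: l x => [|i l IH] x /=; first exact: hc.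
by apply: cvg_sum_seq => s; exact: cvgM.
Qed.

(** The density of a step kernel is a polynomial in masses and coefficients, so it converges as soon
    as these do. The label [x0] is a dummy: all [k] coordinates get overwritten. *)
Definition hom_sum k (p : T -> R) (c : 'I_k * 'I_k -> T -> T -> R) (x0 : T) : R :=
  iter_sum (rev (iota 0 k)) p (fun y => \prod_(e <- edges k) c e (y e.1) (y e.2)) (fun=> x0).

Lemma hom_step k (phi : R -> T) (c : 'I_k * 'I_k -> T -> T -> R) x0 :
  measurable_levels phi ->
  hom (fun e => step phi (c e)) = hom_sum (level_mass phi) c x0.
Proof.
move=> mphi; rewrite /hom /hom_integrand /step /=.
rewrite (@iter_mean_level phi _ (fun y => \prod_(e <- edges k) c e (y e.1) (y e.2)))//.
apply: eq_iter_sum => v v' _ _ vv; apply: eq_bigr => e _.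
by congr (c e _ _); apply: vv; rewrite mem_rev mem_iota/=.
Qed.

Lemma hom_sum_cvg (F : set_system nat) (FF : Filter F) k
    (p_ : nat -> T -> R) p (c_ : nat -> 'I_k * 'I_k -> T -> T -> R) c x0 :
  (forall s, p_ n s @[n --> F] --> p s) ->
  (forall e s t, c_ n e s t @[n --> F] --> c e s t) ->
  hom_sum (p_ n) (c_ n) x0 @[n --> F] --> hom_sum p c x0.
Proof.
move=> pc cc; apply: iter_sum_cvg => // y.
by apply: cvg_prod_seq => e; exact: cc.
Qed.

End finite_iteration.

End FinitePartition.

(** * Partitions of maximal energy *)

Section UltraLimit.
Context {R : realType} (U : set_system nat) (UU : UltraFilter U).
Implicit Types a b : nat -> R.

Definition ulim a : R := lim (a n @[n --> U]).

(** Compactness of [-C, C] gives a cluster point, and a cluster point of an ultrafilter is a limit,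
    since otherwise the complement of the preimage of some neighbourhood would belong to [U]. *)
Lemma ulim_cvg a C : (forall n, `|a n| <= C) -> a n @[n --> U] --> ulim a.
Proof.
move=> aC.
suff [p ap] : exists p : R, a n @[n --> U] --> p by apply/cvg_ex; exists p.
have cC : compact `[- C, C] := @segment_compact R (- C) C.
have [|p [_ clp]] := cC (a n @[n --> U]) _.
  suff : U [set n | `[- C, C]%classic (a n)] by [].
  by apply: filterE => n /=; rewrite in_itv /= -ler_norml; exact: aC.
exists p => V Vp; have [//|UnV] := in_ultra_setVsetC (a @^-1` V) UU.
by have [x []] := clp (~` V) V UnV Vp.
Qed.

Lemma ulimP a l : a n @[n --> U] --> l -> ulim a = l.
Proof. exact: cvg_lim. Qed.

Lemma ulim01 a : (forall n, 0 <= a n <= 1) ->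
  a n @[n --> U] --> ulim a /\ 0 <= ulim a <= 1.
Proof.
move=> a01; have au : a n @[n --> U] --> ulim a.
  by apply: (@ulim_cvg _ 1) => n; have /andP[a0 a1] := a01 n; rewrite ger0_norm.
have ca : cvg (a n @[n --> U]) by apply/cvg_ex; eexists; exact: au.
split => //; apply/andP; split.
  by apply: limr_ge => //; apply: filterE => n; have /andP[] := a01 n.
by apply: limr_le => //; apply: filterE => n; have /andP[] := a01 n.
Qed.

Lemma le_ulim a b : (forall n, 0 <= a n <= 1) -> (forall n, 0 <= b n <= 1) ->
  (forall n, a n <= b n) -> ulim a <= ulim b.
Proof.
move=> /ulim01[ca _] /ulim01[cb _] ab.
apply: ler_lim; [by apply/cvg_ex; eexists; exact: ca|by apply/cvg_ex; eexists; exact: cb|].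
exact: filterE.
Qed.

End UltraLimit.

Section Quantization.
Context {R : realType}.

(** This is [x] rounded down to a multiple of [1 / M], written as an average of threshold bits: a
    [0,1]-valued function becomes a function of the [M] sets on which it is at least [i.+1 / M]. *)
Definition quant M (x : R) : R := M%:R^-1 * \sum_(i < M) (i.+1%:R <= M%:R * x)%R%:R.

Lemma sum01_le m (f : 'I_m -> R) : (forall i, f i <= 1) -> \sum_(i < m) f i <= m%:R.
Proof.
by move=> f1; rewrite (le_trans (ler_sum _ (fun i _ => f1 i)))// sumr_const card_ord.
Qed.

Lemma mean_ord01 m (f : 'I_m -> R) : (0 < m)%N -> (forall i, 0 <= f i <= 1) ->
  0 <= m%:R^-1 * \sum_(i < m) f i <= 1.
Proof.
move=> m0 f01; rewrite mulr_ge0 ?invr_ge0 ?ler0n ?sumr_ge0//=; last first.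
  by move=> i _; have /andP[] := f01 i.
rewrite ler_pdivrMl ?ltr0n// mulr1; apply: sum01_le => i.
by have /andP[] := f01 i.
Qed.

Lemma dist01_le (x y : R) : 0 <= x <= 1 -> 0 <= y <= 1 -> `|x - y| <= 1.
Proof. by move=> /andP[? ?] /andP[? ?]; rewrite ler_norml; apply/andP; split; lra. Qed.

Lemma quant_bounds M (x : R) : (0 < M)%N -> 0 <= x <= 1 ->
  0 <= quant M x <= 1 /\ `|x - quant M x| <= M%:R^-1.
Proof.
move=> M0 /andP[x0 x1]; have M0' : 0 < M%:R :> R by rewrite ltr0n.
pose S : R := \sum_(i < M) (i.+1%:R <= M%:R * x)%R%:R.
have lo (y : R) m : 0 <= y -> \sum_(i < m) (i.+1%:R <= y)%R%:R <= y.
  move=> y0; elim: m => [|m IH]; first by rewrite big_ord0.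
  rewrite big_ord_recr /=; case: (boolP (m.+1%:R <= y)) => my; last by rewrite addr0.
  apply: le_trans my; rewrite -natr1 lerD2r.
  by apply: sum01_le => i; rewrite lern1 leq_b1.
have hi (y : R) m : y <= m%:R -> y <= \sum_(i < m) (i.+1%:R <= y)%R%:R + 1.
  elim: m => [|m IH] ym; first by rewrite big_ord0 add0r (le_trans ym)// ler01.
  rewrite big_ord_recr /=; have [ym'|my] := leP y m%:R.
    by apply: le_trans (IH ym') _; rewrite lerD2r lerDl.
  rewrite (le_trans ym)// -natr1 lerD2r -[leLHS]addr0 lerD//.
  rewrite (eq_bigr (fun=> 1)) ?sumr_const ?card_ord// => i _.
  by rewrite (le_trans _ (ltW my))// ler_nat.
have S0 : 0 <= S by apply: sumr_ge0.
have SM : S <= M%:R * x by apply: lo; rewrite mulr_ge0// ler0n.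
have MS : M%:R * x <= S + 1 by apply: hi; rewrite ler_piMr// ler0n.
have qM : M%:R * quant M x = S by rewrite /quant mulVKf// gt_eqF.
have Mi : M%:R * M%:R^-1 = 1 :> R by rewrite divff// gt_eqF.
have qx : quant M x <= x by rewrite -(ler_pM2l M0') qM.
split; first by rewrite mulr_ge0 ?invr_ge0 ?(ltW M0')//= (le_trans qx).
rewrite ger0_norm ?subr_ge0// -(ler_pM2l M0') mulrBr qM Mi.
by rewrite lerBlDl.
Qed.

End Quantization.

Section Families.
Context {R : realType} (U : set_system nat) (UU : UltraFilter U).
Variable w : nat -> nat -> R * R -> R.
Hypothesis kw : forall n r, kernel (w n r).

(* [A i n] is the [n]-th representative of the [i]-th internal set. *)
Implicit Type A : nat -> nat -> R -> bool.

Definition measurable_family A := forall i n, measurable [set x | A i n x].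

Definition bits (b : nat -> bool) N : N.-tuple bool := Tuple (introT eqP (size_mkseq b N)).

Lemma nth_bits (b : nat -> bool) N i : (i < N)%N -> nth false (bits b N) i = b i.
Proof. by move=> iN; rewrite nth_mkseq. Qed.

Definition fam_code A n N (x : R) : N.-tuple bool := bits (fun i => A i n x) N.

Lemma measurable_code A n N : measurable_family A -> measurable_levels (fam_code A n N).
Proof.
move=> mA s.
have -> : [set x | fam_code A n N x = s] =
    \bigcap_(i in `I_N) [set x | A i n x = nth false s i].
  apply/seteqP; split => [x <- i /= iN|x /= xs]; first by rewrite nth_mkseq.
  apply/val_inj/(@eq_from_nth _ false) => [|i]; rewrite !size_tuple// => iN.
  by rewrite nth_mkseq// xs.
apply: fin_bigcap_measurable => // i _; case: (nth _ _ _); first exact: mA.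
rewrite (_ : [set _ | _] = ~` [set x | A i n x]); first by apply: measurableC; exact: mA.
by apply/seteqP; split => x /=; [move=> -> | move/negP/negbTE].
Qed.

Definition lim_energy A r N := ulim U (fun n => energy (fam_code A n N) (w n r)).

Lemma lim_energy_cvg A r N : measurable_family A ->
  energy (fam_code A n N) (w n r) @[n --> U] --> lim_energy A r N /\ 0 <= lim_energy A r N <= 1.
Proof.
by move=> mA; apply: ulim01 => n; apply: energy01; [exact: measurable_code | exact: kw].
Qed.

Lemma code_factor A B n N M (f : nat -> nat) x :
  (forall i, (i < N)%N -> (f i < M)%N /\ A i n x = B (f i) n x) ->
  fam_code A n N x = bits (fun i => nth false (fam_code B n M x) (f i)) N.
Proof.
move=> AB; apply/val_inj/(@eq_from_nth _ false) => [|i]; rewrite !size_tuple// => iN.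
by have [fM AiB] := AB i iN; rewrite !nth_bits.
Qed.

Lemma lim_energy_le A B r N M (f : nat -> nat) :
  measurable_family A -> measurable_family B ->
  (forall i, (i < N)%N -> (f i < M)%N /\ A i = B (f i)) ->
  lim_energy A r N <= lim_energy B r M.
Proof.
move=> mA mB AB; apply: le_ulim => n.
- by apply: energy01; [exact: measurable_code | exact: kw].
- by apply: energy01; [exact: measurable_code | exact: kw].
apply: (@energy_le_refine _ _ _ _ _ (fun t : M.-tuple bool => bits (fun i => nth false t (f i)) N)).
- exact: measurable_code.
- exact: measurable_code.
- by move=> x; apply: code_factor => i /AB[? ->].
- exact: kw.
Qed.

Definition max_energy r := sup [set e | exists A N, measurable_family A /\ e = lim_energy A r N].

Lemma has_sup_energy r :
  has_sup [set e | exists A N, measurable_family A /\ e = lim_energy A r N].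
Proof.
split.
  exists (lim_energy (fun _ _ _ => false) r 0), (fun _ _ _ => false), 0%N; split => // i n.
  by rewrite (_ : [set _ | _] = set0)//; apply/seteqP; split.
by exists 1 => _ [A [N [mA ->]]]; have [_ /andP[]] := lim_energy_cvg r N mA.
Qed.

Lemma lim_energy_le_max A r N : measurable_family A -> lim_energy A r N <= max_energy r.
Proof. by move=> mA; apply: (sup_upper_bound (has_sup_energy r)); exists A, N. Qed.

(** A near-optimal family is chosen for each kernel [r] and each precision [1 / m.+1], and all of
    them are pooled into one sequence of sets. Adding sets never lowers the energy, so the pool is
    optimal for every [r] at once. *)
Lemma exists_max_family : exists A, measurable_family A /\
  forall r e, 0 < e -> exists N, max_energy r - e < lim_energy A r N.
Proof.
have H (p : nat * nat) : exists BN : (nat -> nat -> R -> bool) * nat, measurable_family BN.1 /\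
    max_energy p.1 - p.2.+1%:R^-1 < lim_energy BN.1 p.1 BN.2.
  have [|e [B [N [mB ->]]] eB] := sup_adherent (eps := p.2.+1%:R^-1) _ (has_sup_energy p.1).
    by rewrite invr_gt0.
  by exists (B, N).
have [BN hBN] := choice H.
pose A i : nat -> R -> bool :=
  if unpickle i is Some (p, j) then (BN p).1 j else fun _ _ => false.
have mA : measurable_family A.
  move=> i n; rewrite /A; case: unpickle => [[p j]|]; first exact: (hBN p).1.
  by rewrite (_ : [set _ | _] = set0)//; apply/seteqP; split.
exists A; split => // r e e0.
have [m me] : exists m : nat, m.+1%:R^-1 < e.
  exists (Num.trunc e^-1); rewrite invf_plt ?posrE// (lt_le_trans (truncnS_gt _))//.
pose p := (r, m).
(* Far enough along the pool to contain all the sets used by [BN p]. *)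
exists (\max_(j < (BN p).2) (pickle (p, nat_of_ord j)).+1)%N.
apply: lt_le_trans (@lim_energy_le _ _ r _ _ (fun j => pickle (p, j)) (hBN p).1 mA _).
  by apply: le_lt_trans (hBN p).2; rewrite lerB// ltW.
move=> j jN; split; last by rewrite /A pickleK.
by apply: leq_trans (leq_bigmax (Ordinal jN)).
Qed.

Lemma lim_energy_mono A r N M : measurable_family A -> (N <= M)%N ->
  lim_energy A r N <= lim_energy A r M.
Proof.
move=> mA NM; apply: (@lim_energy_le A A r N M id) => // i iN; split => //.
exact: leq_trans NM.
Qed.

(** Otherwise [U] contains the set of bad [n], each with a pair of test functions of correlation
    above [2 * e]. Rounding them yields finitely many sets to append to the first [N]. The limit
    energy stays below the maximum, so some bad [n] has an increment under [e ^+ 2]; then the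
    rounded pair correlates by at most [e], and rounding costs at most another [e]. *)
Lemma cond_cut_le A r N e : measurable_family A -> 0 < e ->
  max_energy r - lim_energy A r N < e ^+ 2 ->
  U [set n | cut_le (fun z => w n r z - cond (fam_code A n N) (w n r) z) (2 * e)].
Proof.
move=> mA e0 gap; set S := [set n | _].
have [//|UnS] := in_ultra_setVsetC S UU; exfalso.
pose D n z := w n r z - cond (fam_code A n N) (w n r) z.
have H n : exists ab : (R -> R) * (R -> R),
    [/\ bounded_meas ab.1, bounded_meas ab.2, unit_valued ab.1, unit_valued ab.2 &
     ~ S n -> 2 * e < `|mean2 (fun z => D n z * (ab.1 z.1 * ab.2 z.2))|].
  have [Sn|] := pselect (S n).
    exists (fun=> 0, fun=> 0); split => //=; [exact: bounded_meas_cst..| |];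
      by move=> x; rewrite lexx ler01.
  move=> /existsNP[a /existsNP[b nab]]; exists (a, b).
  have {nab} : [/\ bounded_meas a, bounded_meas b, unit_valued a, unit_valued b &
      ~ `|mean2 (fun z => D n z * (a z.1 * b z.2))| <= 2 * e].
    by apply: contrapT => nn; apply: nab => *; apply: contrapT => ?; apply: nn.
  by move=> [? ? ? ? /negP]; rewrite -ltNge.
have [ab hab] := choice H.
(* Each of the two roundings costs [1 / M], and [2 / M] is at most [e]. *)
pose M := (Num.trunc (2 / e)).+1.
have M0 : 0 < M%:R :> R by rewrite ltr0n.
have Me : 2 * M%:R^-1 <= e.
  by rewrite ler_pdivrMr// mulrC -ler_pdivrMr// ltW// truncnS_gt.
(* The first [N] sets of [A], then [M] threshold sets for each of the two test functions. *)
pose B i n x := if (i < N)%N then A i n x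
  else if (i < N + M)%N then (i - N).+1%:R <= M%:R * (ab n).1 x
  else (i - (N + M)).+1%:R <= M%:R * (ab n).2 x.
have mB : measurable_family B.
  move=> i n; rewrite /B; case: (i < N)%N; first exact: mA.
  have mle (k : nat) (f : R -> R) : bounded_meas f ->
      measurable [set x | (k%:R : R) <= M%:R * f x].
    move=> [mf _]; rewrite -[X in measurable X]setTI.
    apply: (measurable_fun_ler (measurable_cst _)) => //.
    by apply: measurable_funM.
  by have [? ? _ _ _] := hab n; case: (i < N + M)%N; exact: mle.
pose K := (N + M + M)%N.
have gapB : lim_energy B r K - lim_energy A r N < e ^+ 2.
  by apply: le_lt_trans gap; rewrite lerB// lim_energy_le_max.
have Ulow : U [set n | energy (fam_code B n K) (w n r) - energy (fam_code A n N) (w n r) < e ^+ 2].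
  apply: (cvgr_lt _ (cvgB (lim_energy_cvg r K mB).1 (lim_energy_cvg r N mA).1)).
  exact: gapB.
(* Two sets of [U] meet: this [n] has a small increment and is bad. *)
have [n [/= nlow nS]] := filter_ex (filterI Ulow UnS).
have [ba bb ua ub /(_ nS)] := hab n; apply/negP; rewrite -leNgt.
have mphi : measurable_levels (fam_code A n N) by exact: measurable_code.
have mpsi : measurable_levels (fam_code B n K) by exact: measurable_code.
pose h1 (t : K.-tuple bool) : R := M%:R^-1 * \sum_(i < M) (nth false t (N + i))%:R.
pose h2 (t : K.-tuple bool) : R := M%:R^-1 * \sum_(i < M) (nth false t (N + M + i))%:R.
have h1E x : h1 (fam_code B n K x) = quant M ((ab n).1 x).
  congr (_ * _); apply: eq_bigr => i _.
  rewrite nth_bits ?/K -?addnA ?ltn_add2l ?ltn_addr//.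
  by rewrite /B ltnNge leq_addr /= ltn_add2l ltn_ord addKn.
have h2E x : h2 (fam_code B n K x) = quant M ((ab n).2 x).
  congr (_ * _); apply: eq_bigr => i _.
  rewrite nth_bits ?/K ?ltn_add2l//.
  by rewrite /B ltnNge -addnA leq_addr /= ltn_add2l ltnNge leq_addr /= addnA addKn.
have h1q t : 0 <= h1 t <= 1.
  by apply: mean_ord01 => // i; case: (nth _ _ _); rewrite ?lexx ler01.
have h2q t : 0 <= h2 t <= 1.
  by apply: mean_ord01 => // i; case: (nth _ _ _); rewrite ?lexx ler01.
pose c s t := h1 s * h2 t.
have c1 s t : `|c s t| <= 1.
  have /andP[? ?] := h1q s; have /andP[? ?] := h2q t.
  by rewrite /c ger0_norm; [exact: mulr_ile1 | exact: mulr_ge0].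
have [bd ud] := kernel_cond mphi (kw n r); have [bw uw] := kw n r.
have bD : bounded_meas (D n) by exact: bounded_measB.
have D1 z : `|D n z| <= 1.
  exact: dist01_le (uw z) (ud z).
have bc := bounded_meas_step mpsi c.
have bab : bounded_meas (fun z : R * R => (ab n).1 z.1 * (ab n).2 z.2).
  apply: bounded_measM.
    exact: (bounded_meas_comp ba (@measurable_fst _ _ _ _)).
  exact: (bounded_meas_comp bb (@measurable_snd _ _ _ _)).
have := @sqr_mean2_refine_le _ _ _ _ _ (fun t : K.-tuple bool => bits (fun i => nth false t i) N)
  _ mphi mpsi _ (kw n r) c c1.
rewrite -/(D n) => /(_ _)/le_lt_trans/(_ nlow).
have cod x : fam_code A n N x = bits (fun i => nth false (fam_code B n K x) i) N.
  apply: (@code_factor A B n N K id) => i iN; split; last by rewrite /B iN.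
  by rewrite /K -addnA ltn_addr.
move=> /(_ cod) sq.
have lt1 : `|mean2 (fun z => D n z * step (fam_code B n K) c z)| <= e.
  by rewrite ltW// -(ltr_pXn2r (n := 2)) ?nnegrE ?(ltW e0)// real_normK ?num_real.
rewrite (_ : mean2 _ = mean2 (fun z => D n z * step (fam_code B n K) c z) +
    mean2 (fun z => D n z * ((ab n).1 z.1 * (ab n).2 z.2 - step (fam_code B n K) c z))); last first.
  rewrite -mean2D; [|exact: bounded_measM|by apply: bounded_measM => //; exact: bounded_measB].
  by congr mean2; apply/funext => z; ring.
rewrite mulr2n mulrDl mul1r; apply: le_trans (ler_normD _ _) _; apply: lerD => //.
apply: le_trans Me; apply: mean2_norm_le; first by apply: bounded_measM => //; exact: bounded_measB.
move=> z; rewrite normrM -[leRHS]mul1r ler_pM//.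
rewrite /step /c h1E h2E.
have Mn : (0 < M)%N by [].
have [/andP[qa0 qa1] qa] := quant_bounds Mn (ua z.1).
have [/andP[qb0 qb1] qb] := quant_bounds Mn (ub z.2).
have /andP[a0 a1] := ua z.1; have /andP[b0 b1] := ub z.2.
set a := (ab n).1 z.1 in qa qa0 qa1 a0 a1 *; set b := (ab n).2 z.2 in qb qb0 qb1 b0 b1 *.
have -> : a * b - quant M a * quant M b = (a - quant M a) * b + quant M a * (b - quant M b) by ring.
apply: le_trans (ler_normD _ _) _; rewrite [leRHS]mulr_natl mulr2n normrM [X in _ + X <= _]normrM lerD//.
  by rewrite -[leRHS]mulr1 ler_pM// ger0_norm.
by rewrite -[leRHS]mul1r ler_pM// ger0_norm.
Qed.

End Families.

(** * Limits of countable families of kernels *)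

Section IntervalCode.
Context {R : realType}.
Implicit Types (p : seq bool -> R) (s : seq bool) (u : R).

(* The interval coded by [s] is [lo p s, lo p s + p s[: children split their
   parent in proportion to [p], the child with bit [false] on the left. *)
Definition lo p s : R :=
  \sum_(i < size s | nth false s i) p (rcons (take i s) false).

Lemma lo_rcons p s b : lo p (rcons s b) = lo p s + (if b then p (rcons s false) else 0).
Proof.
rewrite /lo size_rcons big_mkcond big_ord_recr /= nth_rcons ltnn eqxx.
rewrite -[X in _ + X]/(if b then p (rcons (take (size s) (rcons s b)) false) else 0).
rewrite -cats1 take_size_cat// [in RHS]big_mkcond; congr (_ + _); apply: eq_bigr => i _.
by rewrite nth_cat ltn_ord takel_cat// ltnW.
Qed.

(** The branch followed by [u]: a bit is [true] when [u] is at or beyond the split point of the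
    current interval. It makes sense for any [p], even one that is not additive. *)
Fixpoint icode p u N : seq bool :=
  if N is N'.+1 then
    let s := icode p u N' in rcons s (lo p s + p (rcons s false) <= u)
  else [::].

Definition ibit p u i : bool :=
  let s := icode p u i in lo p s + p (rcons s false) <= u.

Lemma icodeE p u N : icode p u N = mkseq (ibit p u) N.
Proof. by elim: N => [//|N IH]; rewrite mkseqS -IH. Qed.

Lemma measurable_lo d (T : measurableType d) (p : T -> seq bool -> R) s :
  (forall s, measurable_fun setT (p ^~ s)) -> measurable_fun setT (fun z => lo (p z) s).
Proof.
move=> mp; rewrite /lo; elim: (index_enum _) => [|i r IH].
  by under eq_fun do rewrite big_nil; exact: measurable_cst.
under eq_fun do rewrite big_cons; case: (nth false s i) => //.
by apply: measurable_funD.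
Qed.

(** Joint measurability in the tree [p z] and the point of [0,1] is what makes the limit graphon
    measurable; a fixed tree is the constant case. *)
Lemma measurable_icode d (T : measurableType d) (p : T -> seq bool -> R) s :
  (forall s, measurable_fun setT (p ^~ s)) ->
  measurable [set z : T * R | icode (p z.1) z.2 (size s) = s].
Proof.
move=> mp; elim/last_ind: s => [|s b IH].
  by rewrite (_ : [set _ | _] = setT)//; apply/seteqP; split.
have mle : measurable [set z : T * R | lo (p z.1) s + p z.1 (rcons s false) <= z.2].
  rewrite -[X in measurable X]setTI.
  apply: (measurable_fun_ler (f := fun z : T * R => lo (p z.1) s + p z.1 (rcons s false))) => //.
    apply: measurable_funD.
      exact: (measurableT_comp (measurable_lo s mp) (@measurable_fst _ _ _ _)).
    exact: (measurableT_comp (mp _) (@measurable_fst _ _ _ _)).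
rewrite (_ : [set _ | _] = [set z : T * R | icode (p z.1) z.2 (size s) = s] `&`
    (if b then [set z : T * R | lo (p z.1) s + p z.1 (rcons s false) <= z.2]
     else ~` [set z : T * R | lo (p z.1) s + p z.1 (rcons s false) <= z.2])).
  by apply: measurableI => //; case: b => //; exact: measurableC.
apply/seteqP; split => z; rewrite size_rcons /=.
  by move/rcons_inj => [-> <-]; split => //; case: ifPn => // /negP.
by move=> [zs]; rewrite zs; case: b => /= [->//|/negP/negbTE ->].
Qed.

Section tree.
Variable p : seq bool -> R.
Hypotheses (p_ge0 : forall s, 0 <= p s) (p_nil : p [::] = 1).
Hypothesis p_split : forall s, p s = p (rcons s false) + p (rcons s true).

Lemma lo_bounds s : 0 <= lo p s /\ lo p s + p s <= 1.
Proof.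
elim/last_ind: s => [|s b [l0 l1]]; first by rewrite /lo big_ord0 add0r p_nil.
move: l1; rewrite lo_rcons p_split; have := p_ge0 (rcons s true).
have := p_ge0 (rcons s false); case: b; move: (lo p s) l0 => l;
  move: (p _) (p _) => a b l0 a0 b0 l1; split; lra.
Qed.

(** The two children tile the half-open interval of [s], so the next bit says on which side of the
    split point [u] lies; [0 <= u < 1] is the case of the root. *)
Lemma icode_eq s u : 0 <= u < 1 -> (icode p u (size s) == s) = (lo p s <= u < lo p s + p s).
Proof.
move=> u01; elim/last_ind: s => [|s b IH].
  by rewrite /lo big_ord0 add0r p_nil u01.
rewrite size_rcons /= eqseq_rcons lo_rcons.
have -> : (icode p u (size s) == s) && ((lo p (icode p u (size s)) +
    p (rcons (icode p u (size s)) false) <= u) == b) =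
    (icode p u (size s) == s) && ((lo p s + p (rcons s false) <= u) == b).
  by case: eqP => [->|].
rewrite IH p_split; have := p_ge0 (rcons s true).
have := p_ge0 (rcons s false); case: b; move: (lo p s) => l;
  move: (p _) (p _) => a b b0 a0.
  rewrite eqb_id; case: (leP (l + b) u) => h; rewrite ?andbF ?andbT.
    by rewrite addrA; congr andb; apply/idP; rewrite (le_trans _ h)// lerDl.
  by [].
rewrite addr0 eqbF_neg -ltNge; case: (ltP u (l + b)) => h; rewrite ?andbF ?andbT//.
suff -> : u < l + (b + a) by rewrite andbT.
by rewrite (lt_le_trans h)// addrA lerDl.
Qed.

Lemma measurable_ibit N : measurable_levels (fun u => bits (ibit p u) N).
Proof.
move=> s; have := @measurable_icode _ R (fun=> p) s (fun s => measurable_cst _).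
move=> /(pair1_measurable (0 : R) measurableT); rewrite setTI.
congr measurable; apply/seteqP; split => u /=; rewrite icodeE size_tuple.
  by move=> us; apply/val_inj.
by move=> <-.
Qed.

Lemma level_mass_icode N (s : N.-tuple bool) :
  level_mass (fun u => bits (ibit p u) N) s = p s.
Proof.
have mJ := @measurable_ibit N; have [l0 l1] := lo_bounds s.
rewrite /level_mass (@mean1_co _ (lo p s) (lo p s + p s)) ?lerDl//.
- by rewrite addrAC subrr add0r.
- exact: bounded_meas_level_indic.
- move=> u u0 u1; rewrite /level_indic -icode_eq ?u0//.
  by rewrite -val_eqE /= -icodeE size_tuple.
Qed.

End tree.

End IntervalCode.

(** * Limits of masses and averages along the ultrafilter *)

Section LimitKernel.
Context {R : realType} (U : set_system nat) (UU : UltraFilter U).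
Variable w : nat -> nat -> R * R -> R.
Hypothesis kw : forall n r, kernel (w n r).
Variable A : nat -> nat -> R -> bool.
Hypothesis mA : measurable_family A.
Local Notation code := (fam_code A).

(** Indexed by lists rather than tuples, so that all levels form a single tree of masses to which
    the interval code applies. *)
Definition lim_mass (s : seq bool) : R :=
  ulim U (fun n => level_mass (code n (size s)) (in_tuple s)).

Lemma level_mass01 (T : finType) (phi : R -> T) s : measurable_levels phi ->
  0 <= level_mass phi s <= 1.
Proof.
move=> mphi; rewrite level_mass_ge0 /level_mass -[leRHS](mean1_cst (1 : R)).
apply: le_mean1; [exact: bounded_meas_level_indic|exact: bounded_meas_cst|move=> x].
by rewrite /level_indic lern1 leq_b1.
Qed.

Lemma level_mass_in_tuple n N (s : N.-tuple bool) :
  level_mass (code n (size s)) (in_tuple s) = level_mass (code n N) s.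
Proof.
rewrite /level_mass; congr mean1; apply/funext => x; rewrite /level_indic.
by rewrite -!val_eqE /= size_tuple.
Qed.

Lemma lim_mass_cvg N (s : N.-tuple bool) :
  level_mass (code n N) s @[n --> U] --> lim_mass s.
Proof.
rewrite /lim_mass; under eq_fun do rewrite -level_mass_in_tuple.
by apply: (ulim01 _ _).1 => m; apply: level_mass01; exact: measurable_code.
Qed.

Lemma lim_mass_ge0 s : 0 <= lim_mass s.
Proof.
suff /andP[] : 0 <= lim_mass s <= 1 by [].
by apply: (ulim01 _ _).2 => m; apply: level_mass01; exact: measurable_code.
Qed.

Lemma lim_mass_nil : lim_mass [::] = 1.
Proof.
apply: ulimP; rewrite (_ : (fun _ => _) = fun=> 1); first exact: cvg_cst.
apply/funext => n; rewrite /level_mass -[RHS](mean1_cst (1 : R)); congr mean1.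
Qed.

Lemma lim_mass_split s : lim_mass s = lim_mass (rcons s false) + lim_mass (rcons s true).
Proof.
apply: ulimP.
rewrite (_ : (fun _ => _) = fun n =>
    level_mass (code n (size s).+1) (rcons_tuple (in_tuple s) false) +
    level_mass (code n (size s).+1) (rcons_tuple (in_tuple s) true)).
  by apply: cvgD; exact: lim_mass_cvg.
apply/funext => n; rewrite -mean1D; [|apply: bounded_meas_level_indic; exact: measurable_code..].
congr mean1; apply/funext => x; rewrite /level_indic -!val_eqE /= mkseqS !eqseq_rcons.
by case: (_ == s); case: (A _ _ _); rewrite ?addr0 ?add0r.
Qed.

Definition lim_code N (u : R) : N.-tuple bool := bits (ibit lim_mass u) N.

Lemma measurable_lim_code N : measurable_levels (lim_code N).
Proof. exact: measurable_ibit. Qed.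

Lemma level_mass_lim_code N s : level_mass (lim_code N) s = lim_mass s.
Proof.
by apply: level_mass_icode; [exact: lim_mass_ge0|exact: lim_mass_nil|exact: lim_mass_split].
Qed.

Definition lim_coef r N (s t : N.-tuple bool) : R :=
  ulim U (fun n => cond_coef (code n N) (w n r) s t).

Definition lim_step r N : R * R -> R := step (lim_code N) (lim_coef r (N := N)).

Lemma lim_coef_cvg r N s t :
  cond_coef (code n N) (w n r) s t @[n --> U] --> lim_coef r s t.
Proof.
by apply: (ulim01 _ _).1 => n; apply: cond_coef01; [exact: measurable_code|exact: kw].
Qed.

Lemma kernel_lim_step r N : kernel (lim_step r N).
Proof.
split; first by apply: bounded_meas_step; exact: measurable_lim_code.
move=> z; apply: (ulim01 _ _).2 => n.
by apply: cond_coef01; [exact: measurable_code|exact: kw].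
Qed.

Lemma hom_lim_step_cvg k (f : 'I_k * 'I_k -> nat) N :
  hom (fun e => cond (code n N) (w n (f e))) @[n --> U] --> hom (fun e => lim_step (f e) N).
Proof.
pose x0 : N.-tuple bool := [tuple of nseq N false].
rewrite /lim_step (hom_step _ x0); last exact: measurable_lim_code.
rewrite (_ : (fun _ => _) = fun n =>
    hom_sum (level_mass (code n N)) (fun e => cond_coef (code n N) (w n (f e))) x0).
  apply: hom_sum_cvg => [s|e s t]; last exact: lim_coef_cvg.
  by rewrite level_mass_lim_code; exact: lim_mass_cvg.
by apply/funext => n; rewrite -hom_step//; exact: measurable_code.
Qed.

(** The squared L2 distance is a polynomial in the limit masses and coefficients, hence the limit of
    the distances between averages, which [energy_refine] turns into energy increments. *)
Lemma mean2_lim_step_diff r N M : (N <= M)%N ->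
  mean2 (fun z => (lim_step r M z - lim_step r N z) ^+ 2) =
  lim_energy U w A r M - lim_energy U w A r N.
Proof.
move=> NM; pose g (t : M.-tuple bool) : N.-tuple bool := bits (nth false t) N.
have gbits (b : nat -> bool) : bits b N = g (bits b M).
  apply/val_inj/(@eq_from_nth _ false) => [|i]; rewrite !size_tuple// => iN.
  by rewrite !nth_bits// (leq_trans iN).
have gcode n x : code n N x = g (code n M x) by exact: gbits.
have mM n : measurable_levels (code n M) by exact: measurable_code.
have mN n : measurable_levels (code n N) by exact: measurable_code.
pose c n (s t : M.-tuple bool) :=
  (cond_coef (code n M) (w n r) s t - cond_coef (code n N) (w n r) (g s) (g t)) ^+ 2.
pose c' (s t : M.-tuple bool) := (lim_coef r s t - lim_coef r (g s) (g t)) ^+ 2.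
have -> : (fun z => (lim_step r M z - lim_step r N z) ^+ 2) = step (lim_code M) c'.
  by apply/funext => z; rewrite /lim_step /step /lim_code !(gbits (ibit _ _)).
rewrite (mean2_step (@measurable_lim_code M)).
pose X n := mean2 (fun z => (cond (code n M) (w n r) z - cond (code n N) (w n r) z) ^+ 2).
have XE n : X n = energy (code n M) (w n r) - energy (code n N) (w n r).
  exact: (energy_refine (mN n) (mM n) (gcode n) (kw n r)).
have X1 : X n @[n --> U] --> lim_energy U w A r M - lim_energy U w A r N.
  by under eq_fun do rewrite XE; apply: cvgB; exact: (lim_energy_cvg UU kw r _ mA).1.
rewrite -(ulimP UU X1); apply/esym/ulimP.
rewrite (_ : X = fun n => \sum_s \sum_t
    c n s t * (level_mass (code n M) s * level_mass (code n M) t)).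
  apply: cvg_sum_seq => s; apply: cvg_sum_seq => t; apply: cvgM.
    by rewrite /c; apply: cvgM; apply: cvgB; exact: lim_coef_cvg.
  by apply: cvgM; rewrite level_mass_lim_code; exact: lim_mass_cvg.
apply/funext => n; rewrite -(mean2_step (mM n) (c n)) /X; congr (mean2 _); apply/funext => z.
by rewrite /cond /step /c !gcode.
Qed.

End LimitKernel.

(** * Convergence of the step kernels and of homomorphism densities *)

Section Compactness.
Context {R : realType} (U : set_system nat) (UU : UltraFilter U).
Variable w : nat -> nat -> R * R -> R.
Hypothesis kw : forall n r, kernel (w n r).
Local Notation leb := (@lebesgue_measure R).
Local Notation I := (@I01 R).

Lemma ae_square_imp (P Q : R * R -> Prop) : (forall z, P z -> Q z) ->
  {ae (leb \x leb)%E, forall z, P z} -> {ae (leb \x leb)%E, forall z, Q z}.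
Proof. exact: (@filterS _ _ (@ae_filter_ringOfSetsType _ _ _ (leb \x leb)%E)). Qed.

Lemma cut_le_L1 (v : R * R -> R) : bounded_meas v -> cut_le v (mean2 (fun z => `|v z|)).
Proof.
move=> bv a b ba bb ua ub.
have bva : bounded_meas (fun z : R * R => v z * (a z.1 * b z.2)).
  apply: bounded_measM => //; apply: bounded_measM.
    exact: (bounded_meas_comp ba (@measurable_fst _ _ _ _)).
  exact: (bounded_meas_comp bb (@measurable_snd _ _ _ _)).
apply: le_trans (ler_norm_mean2 bva) _.
apply: le_mean2; [exact: bounded_meas_norm|exact: bounded_meas_norm|move=> z].
have /andP[a0 a1] := ua z.1; have /andP[b0 b1] := ub z.2.
rewrite normrM -[leRHS]mulr1 ler_wpM2l// ger0_norm; [exact: mulr_ile1|exact: mulr_ge0].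
Qed.

Lemma norm_sqrt_le (x e : R) : 0 <= x -> 0 <= e -> x ^+ 2 <= e ^+ 2 -> x <= e.
Proof. by move=> x0 e0; rewrite ler_pXn2r ?nnegrE. Qed.

Lemma mean2_norm_le_sqrt (v : R * R -> R) e : bounded_meas v -> 0 <= e ->
  mean2 (fun z => v z ^+ 2) <= e ^+ 2 -> mean2 (fun z => `|v z|) <= e.
Proof.
move=> bv e0 ve; apply: norm_sqrt_le => //; first by apply: mean2_ge0 => z; exact: normr_ge0.
apply: le_trans (sqr_mean2_le (bounded_meas_norm bv)) (le_trans _ ve).
by rewrite le_eqVlt; apply/orP; left; apply/eqP; congr (mean2 _); apply/funext => z; rewrite real_normK ?num_real.
Qed.

Variable A : nat -> nat -> R -> bool.
Hypothesis mA : measurable_family A.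
Hypothesis maxA : forall r e, 0 < e ->
  exists N, max_energy U w r - e < lim_energy U w A r N.

Let gap r N := max_energy U w r - lim_energy U w A r N.

(** One sequence of levels serves all kernels, since stage [j] has to control only those of index
    [r <= j]. The square absorbs the passage from L2 to L1 and leaves the summable bound
    [1 / 2 ^ j.+1]. *)
Lemma exists_levels : exists F : nat -> nat, {homo F : i j / (i <= j)%N} /\
  forall r j, (r <= j)%N -> gap r (F j) < (1 / (2 ^ j.+1)%:R) ^+ 2.
Proof.
have e0 j : 0 < (1 / (2 ^ j.+1)%:R : R) ^+ 2.
  by rewrite exprn_gt0// divr_gt0// ltr0n expn_gt0.
have /choice[N hN] : forall p : nat * nat, exists N, gap p.1 N < (1 / (2 ^ p.2.+1)%:R) ^+ 2.
  move=> p; have [N hN] := maxA p.1 (e0 p.2); exists N.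
  by rewrite /gap ltrBlDr addrC -ltrBlDr.
(* Including the earlier stages [i] in the maximum makes [F] monotone. *)
pose F j := (\max_(i < j.+1) \max_(r < j.+1) N (r : nat, i : nat))%N.
have FN r i j : (r <= j)%N -> (i <= j)%N -> (N (r, i) <= F j)%N.
  move=> rj ij; have rj' : (r < j.+1)%N by []. have ij' : (i < j.+1)%N by [].
  apply: leq_trans (leq_bigmax (Ordinal ij')).
  exact: (leq_trans _ (leq_bigmax (Ordinal rj'))).
exists F; split => [i j ij|r j rj].
  by apply/bigmax_leqP => a _; apply/bigmax_leqP => b _; apply: FN;
    rewrite (leq_trans _ ij)// -ltnS.
apply: le_lt_trans (hN (r, j)); rewrite /gap; apply: lerB; first exact: lexx.
by apply: (lim_energy_mono UU kw r mA); exact: FN.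
Qed.

Section levels.
Variable F : nat -> nat.
Hypothesis Fmono : {homo F : i j / (i <= j)%N}.
Hypothesis Fgap : forall r j, (r <= j)%N -> gap r (F j) < (1 / (2 ^ j.+1)%:R) ^+ 2.

Definition approx r j : R * R -> R := lim_step U w A r (F j).

Lemma kernel_approx r j : kernel (approx r j).
Proof. exact: kernel_lim_step. Qed.

(** Squared L2 distances of consecutive approximations are energy increments, hence at most the gap
    at the earlier stage. One null set serves the countably many [r]. *)
Lemma ae_cvg_approx :
  {ae (leb \x leb)%E, forall z, (I `*` I) z -> forall r, cvgn (approx r ^~ z)}.
Proof.
have H r : {ae (leb \x leb)%E, forall z, (I `*` I) z -> cvgn (approx r ^~ z)}.
  apply: (@ae_cvg_of_mean2_diff _ _ r) => [n|j rj]; first exact: (kernel_approx r n).1.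
  apply: mean2_norm_le_sqrt.
  - by apply: bounded_measB; exact: (kernel_approx _ _).1.
  - by rewrite divr_ge0.
  rewrite mean2_lim_step_diff//; last exact: Fmono.
  apply: le_trans (ltW (Fgap rj)); rewrite /gap; apply: lerB; last exact: lexx.
  exact: lim_energy_le_max.
have := ae_foralln H; apply: filterS => z cz zI r; exact: cz.
Qed.

(** A limit superior is measurable and defined off the convergence set too; the clamp makes values
    in [0,1] immediate. *)
Definition limit_kernel r (z : R * R) : R :=
  Num.min 1 (Num.max 0 (fine (limn_esup (fun j => (approx r j z)%:E)))).

Lemma limit_kernel_cvg r z : cvgn (approx r ^~ z) -> approx r j z @[j --> \oo] --> limit_kernel r z.
Proof.
move=> cz; rewrite /limit_kernel.
have cl : approx r j z @[j --> \oo] --> lim (approx r j z @[j --> \oo]) by [].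
set l := lim _ in cl *.
have l0 : 0 <= l by apply: limr_ge => //; apply: nearW => j; have /andP[] := (kernel_approx r j).2 z.
have l1 : l <= 1 by apply: limr_le => //; apply: nearW => j; have /andP[] := (kernel_approx r j).2 z.
have -> : limn_esup (fun j => (approx r j z)%:E) = l%:E.
  by apply: (cvg_limn_einf_sup _).2; apply: cvg_EFin => //; exact: nearW.
by rewrite /= max_r// min_r.
Qed.

Lemma kernel_limit r : kernel (limit_kernel r).
Proof.
have u01 : unit_valued (limit_kernel r).
  by move=> z; rewrite /limit_kernel le_min ler01 le_max lexx /= ge_min lexx.
split=> //; split; last first.
  by exists 1 => z; have /andP[u0 u1] := u01 z; rewrite ger0_norm.
apply: measurable_minr; first exact: measurable_cst.
apply: measurable_maxr; first exact: measurable_cst.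
apply: measurableT_comp; first exact: fine_measurable.
apply: measurable_fun_limn_esup => j; apply/measurable_EFinP.
exact: (kernel_approx r j).1.1.
Qed.

Lemma mean2_approx_cvg r :
  mean2 (fun z => `|approx r j z - limit_kernel r z|) @[j --> \oo] --> 0.
Proof.
have bd j : bounded_meas (fun z => approx r j z - limit_kernel r z).
  by apply: bounded_measB; [exact: (kernel_approx r j).1|exact: (kernel_limit r).1].
rewrite -(mean2_cst (0 : R)); apply: (@mean2_dominated_cvg _ _ _ 1).
- by move=> j; exact: bounded_meas_norm.
- exact: bounded_meas_cst.
- move=> j z; rewrite normr_id.
  exact: dist01_le ((kernel_approx r j).2 z) ((kernel_limit r).2 z).
apply: ae_square_imp ae_cvg_approx => z cz /cz /(_ r) /limit_kernel_cvg cl.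
rewrite -(normr0 R) -(subrr (limit_kernel r z)); apply: cvg_norm.
by apply: cvgB => //; exact: cvg_cst.
Qed.

(** At one well-chosen stage [j], three comparisons: kernels with averages in cut norm, averages
    with [approx] along [U], and [approx] with its limit in L1. *)
Lemma hom_limit_cvg k (f : 'I_k * 'I_k -> nat) :
  hom (fun e => w n (f e)) @[n --> U] --> hom (fun e => limit_kernel (f e)).
Proof.
apply/cvgrPdist_le => e e0.
set E := (size (edges k))%:R : R.
have E0 : 0 <= E by rewrite /E ler0n.
(* Chosen so that the three errors [E * d], [d] and [E * d] add up to [e]. *)
pose d := e / (2 * E + 1).
have d0 : 0 < d by rewrite divr_gt0//; lra.
have dE : E * d + d + E * d = e.
  by rewrite /d; field; lra.
have near1 : \forall j \near \oo, forall a : 'I_k * 'I_k,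
    mean2 (fun z => `|approx (f a) j z - limit_kernel (f a) z|) <= d.
  apply: filter_forall => a.
  have := mean2_approx_cvg (f a) => /cvgrPdist_le /(_ d d0); apply: filterS => j.
  by rewrite sub0r normrN; apply: le_trans; exact: ler_norm.
(* Half of [d], because [cond_cut_le] loses a factor 2. *)
have near2 : \forall j \near \oo, forall a : 'I_k * 'I_k, gap (f a) (F j) < (d / 2) ^+ 2.
  apply: filter_forall => a.
  have d20 : 0 < d / 2 by rewrite divr_gt0.
  have half1 : `|2^-1 : R| < 1 by rewrite ger0_norm ?invr_ge0// invf_lt1// ltr1n.
  have := cvg_expr half1 => /cvgrPdist_le /(_ _ d20); apply: filterS2 (nbhs_infty_ge (f a)).
  move=> j aj; rewrite sub0r normrN ger0_norm ?exprn_ge0// ?invr_ge0// => jd.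
  have p0 : 0 <= 1 / (2 ^ j.+1)%:R :> R by rewrite divr_ge0.
  apply: lt_le_trans (Fgap aj) _; rewrite ler_pXn2r ?nnegrE ?p0 ?(ltW d20)//.
  apply: le_trans jd; rewrite div1r natrX -exprVn; apply: ler_wiXn2l => //.
  by rewrite invf_le1// ler1n.
have [j [/= j1 j2]] := filter_ex (filterI near1 near2).
have cut : \forall n \near U, forall a : 'I_k * 'I_k,
    cut_le (fun z => w n (f a) z - cond (fam_code A n (F j)) (w n (f a)) z) d.
  apply: filter_forall => a.
  have := cond_cut_le UU kw mA (_ : 0 < d / 2) (j2 a).
  by rewrite divr_gt0// mulrC divfK//; apply.
have := @hom_lim_step_cvg R U UU w kw A mA k f (F j) => /cvgrPdist_le /(_ d d0).
apply: filterS2 cut => n cutn homn.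
have h1 : `|hom (fun e => w n (f e)) - hom (fun e => cond (fam_code A n (F j)) (w n (f e)))| <= E * d.
  apply: hom_cut_le => a; [exact: kw| |exact: cutn].
  by apply: kernel_cond; [exact: measurable_code|exact: kw].
have h2 : `|hom (fun e => approx (f e) j) - hom (fun e => limit_kernel (f e))| <= E * d.
  apply: hom_cut_le => a; [exact: kernel_approx|exact: kernel_limit|].
  move=> x y bx by_ ux uy; apply: le_trans (j1 a).
  by apply: cut_le_L1 => //; apply: bounded_measB; [exact: (kernel_approx _ _).1|exact: (kernel_limit _).1].
have h3 : `|hom (fun e => approx (f e) j) -
    hom (fun e => cond (fam_code A n (F j)) (w n (f e)))| <= d by exact: homn.
rewrite -dE; apply: le_trans (ler_distD (hom (fun e => cond (fam_code A n (F j)) (w n (f e)))) _ _) _.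
rewrite [X in _ + X <= _]distrC lerD//.
apply: le_trans (ler_distD (hom (fun e => approx (f e) j)) _ _) _.
by rewrite distrC lerD.
Qed.

Lemma limit_kernel_sym r : (forall n x y, w n r (x, y) = w n r (y, x)) ->
  forall x y, limit_kernel r (x, y) = limit_kernel r (y, x).
Proof.
move=> sw x y.
have aE j : approx r j (x, y) = approx r j (y, x).
  rewrite /approx /lim_step /step /lim_coef; congr (ulim U _); apply/funext => n.
  exact: (cond_coef_sym (@measurable_code R A n (F j) mA) (kw n r).1 (sw n)).
have E : (fun j => (approx r j (x, y))%:E) = (fun j => (approx r j (y, x))%:E).
  by apply/funext => j; rewrite aE.
exact: (congr1 (fun v => Num.min 1 (Num.max 0 (fine (limn_esup v)))) E).
Qed.

(** Since the atoms are common to all kernels, the relation holds for each averaged coefficient,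
    then for the approximations, then at any point where these converge. *)
Lemma limit_kernel_split z r r0 r1 : (forall r, cvgn (approx r ^~ z)) ->
  (forall n z, w n r z = w n r0 z + w n r1 z) ->
  limit_kernel r z = limit_kernel r0 z + limit_kernel r1 z.
Proof.
move=> cz ww.
have aE j : approx r j z = approx r0 j z + approx r1 j z.
  apply: (ulimP UU); rewrite (_ : (fun _ => _) = fun n =>
      cond_coef (fam_code A n (F j)) (w n r0) (lim_code U A (F j) z.1) (lim_code U A (F j) z.2) +
      cond_coef (fam_code A n (F j)) (w n r1) (lim_code U A (F j) z.1) (lim_code U A (F j) z.2)).
    by apply: cvgD; exact: lim_coef_cvg.
  apply/funext => n; apply: cond_coefD; [exact: measurable_code| | |exact: ww].
    exact: (kw n r0).1.
  exact: (kw n r1).1.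
rewrite -(cvg_lim (@Rhausdorff R) (limit_kernel_cvg (cz r))).
apply: cvg_lim => //; under eq_fun do rewrite aE.
by apply: cvgD; exact: limit_kernel_cvg.
Qed.

Lemma limit_kernel1 z r : (forall r, cvgn (approx r ^~ z)) ->
  (forall n z, (I `*` I) z -> w n r z = 1) -> limit_kernel r z = 1.
Proof.
move=> cz w1; rewrite -(cvg_lim (@Rhausdorff R) (limit_kernel_cvg (cz r))).
apply: cvg_lim => //; rewrite (_ : (fun _ => _) = fun=> 1); first exact: cvg_cst.
apply/funext => j; apply: (ulimP UU).
rewrite (_ : (fun _ => _) = fun=> 1); first exact: cvg_cst.
by apply/funext => n; apply: cond_coef1; [exact: measurable_code|exact: w1].
Qed.

End levels.

End Compactness.

(** The relations are quantified inside the almost everywhere clause, so one null set serves the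
    whole tree of cells. *)
Theorem kernel_compactness (R : realType) (U : set_system nat) (UU : UltraFilter U)
    (w : nat -> nat -> R * R -> R) :
  (forall n r, kernel (w n r)) ->
  (forall n r x y, w n r (x, y) = w n r (y, x)) ->
  exists u : nat -> R * R -> R,
  [/\ forall r, kernel (u r),
      forall r x y, u r (x, y) = u r (y, x),
      forall k (f : 'I_k * 'I_k -> nat),
        hom (fun e => w n (f e)) @[n --> U] --> hom (fun e => u (f e)) &
      {ae (@lebesgue_measure R \x @lebesgue_measure R)%E, forall z, (@I01 R `*` @I01 R) z ->
        (forall r r0 r1, (forall n z, w n r z = w n r0 z + w n r1 z) ->
           u r z = u r0 z + u r1 z) /\
        (forall r, (forall n z, (@I01 R `*` @I01 R) z -> w n r z = 1) -> u r z = 1)}].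
Proof.
move=> kw sw.
have [A [mA maxA]] := exists_max_family UU kw.
have [F [Fmono Fgap]] := exists_levels UU kw mA maxA.
exists (limit_kernel U w A F); split.
- by move=> r; exact: kernel_limit.
- by move=> r x y; apply: limit_kernel_sym => // n; exact: sw.
- by move=> k f; exact: hom_limit_cvg.
apply: ae_square_imp (ae_cvg_approx UU kw mA Fmono Fgap) => z cz zI; split.
  by move=> r r0 r1 ww; apply: limit_kernel_split => //; exact: cz.
by move=> r w1; apply: limit_kernel1 => //; exact: cz.
Qed.

(** * Densities under approximation *)

Section Multilinear.
Context {R : realType}.

Lemma prod_diff_le (J : Type) (r : seq J) (a b : J -> R) C : 1 <= C ->
  (forall j, `|a j| <= C) -> (forall j, `|b j| <= C) ->
  `|\prod_(j <- r) a j - \prod_(j <- r) b j| <= C ^+ size r * \sum_(j <- r) `|a j - b j|.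
Proof.
move=> C1 aC bC; have C0 : 0 <= C by apply: le_trans C1.
have pC (h : J -> R) (q : seq J) : (forall j, `|h j| <= C) -> `|\prod_(j <- q) h j| <= C ^+ size q.
  move=> hC; elim: q => [|j q IH]; first by rewrite big_nil expr0 normr1.
  by rewrite big_cons normrM exprS ler_pM.
elim: r => [|j r IH]; first by rewrite !big_nil subrr normr0 mulr0.
rewrite !big_cons /= exprS.
have -> : a j * \prod_(i <- r) a i - b j * \prod_(i <- r) b i =
  (a j - b j) * \prod_(i <- r) a i + b j * (\prod_(i <- r) a i - \prod_(i <- r) b i) by ring.
apply: le_trans (ler_normD _ _) _; rewrite [leRHS]mulrDr; apply: lerD; rewrite normrM.
  rewrite mulrC ler_wpM2r//; apply: le_trans (pC _ _ aC) _.
  by rewrite ler_peMl// exprn_ge0.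
by rewrite -mulrA ler_pM.
Qed.

(** For kernels that are bounded but not [0,1]-valued. The integrands differ pointwise by at most a
    constant times the sum of [D p] over the edges, and [iter_mean_cut_le] with test functions 1
    bounds the mean of each term. *)
Lemma hom_L1_le k (w w' : 'I_k * 'I_k -> R * R -> R) C d : 1 <= C ->
  (forall p, bounded_meas (w p)) -> (forall p, bounded_meas (w' p)) ->
  (forall p z, `|w p z| <= C) -> (forall p z, `|w' p z| <= C) ->
  (forall p, mean2 (fun z => `|w p z - w' p z|) <= d) ->
  `|hom w - hom w'| <= C ^+ size (edges k) * ((size (edges k))%:R * d).
Proof.
move=> C1 bw bw' wC wC' wd.
have nw := nice_hom_integrand bw; have nw' := nice_hom_integrand bw'.
pose D p z := `|w p z - w' p z|.
have bD p : bounded_meas (D p) by apply: bounded_meas_norm; exact: bounded_measB.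
pose S (x : nat -> R) := \sum_(p <- edges k) D p (x p.1, x p.2).
have nD (p : 'I_k * 'I_k) : nice (fun x => D p (x p.1, x p.2)) by exact: nice_kernel.
have nS : nice S by exact: nice_sum.
have nCS : nice (fun x => C ^+ size (edges k) * S x) by exact: niceZ.
rewrite /hom -iter_meanB//.
have mono l (f g : (nat -> R) -> R) (x : nat -> R) : nice f -> nice g -> (forall y, `|f y| <= g y) ->
    `|iter_mean l f x| <= iter_mean l g x.
  move=> nf ng fg; elim: l x => [|i l IH] x /=; first exact: fg.
  have bf := nice_update x i (nice_iter_mean l nf).
  have bg := nice_update x i (nice_iter_mean l ng).
  have le1 : mean1 (fun t => iter_mean l f (update x i t)) <= mean1 (fun t => iter_mean l g (update x i t)).
    by apply: le_mean1 => // t; apply: le_trans (IH _); exact: ler_norm.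
  have le2 : mean1 (fun t => - iter_mean l g (update x i t)) <= mean1 (fun t => iter_mean l f (update x i t)).
    apply: le_mean1 => [|//|t]; first exact: bounded_measN.
    by rewrite lerNl; apply: le_trans (IH _); rewrite -normrN; exact: ler_norm.
  rewrite ler_norml le1 andbT; apply: le_trans le2.
  rewrite le_eqVlt; apply/orP; left; apply/eqP; rewrite -mulN1r -mean1Z//.
  by congr mean1; apply/funext => t; rewrite mulN1r.
apply: le_trans (mono _ _ _ _ (niceB nw nw') nCS _) _.
  by move=> y; apply: (@prod_diff_le _ (edges k) (fun p => w p (y p.1, y p.2)) (fun p => w' p (y p.1, y p.2))) => // p.
rewrite iter_meanZ// ler_wpM2l ?exprn_ge0 ?(le_trans ler01)//.
rewrite iter_mean_sum//; apply: (@le_trans _ _ (\sum_(p <- edges k) d)).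
  rewrite !big_seq; apply: ler_sum => p; rewrite mem_edges => p12.
  have := @iter_mean_cut_le R (rev (iota 0 k)) p.1 p.2 (D p) (fun=> 1) (fun=> 1) (fun=> 0) d.
  have DE : (fun y : nat -> R => D p (y p.1, y p.2)) = fun y => D p (y p.1, y p.2) * (1 * 1).
    by apply/funext => y; rewrite !mulr1.
  rewrite DE; move=> H; apply: le_trans (ler_norm _) (H _ _ _ _ _ _ _ _ _ _ _) => //.
  - by rewrite neq_ltn p12.
  - by rewrite mem_rev mem_iota /=.
  - by rewrite mem_rev mem_iota /=.
  - move=> a b ba bb ua ub; apply: le_trans (wd p).
    have := cut_le_L1 (bD p) ba bb ua ub.
    congr (_ <= mean2 _); apply/funext => z; exact: normr_id.
  - exact: nice_cst.
  - exact: nice_cst.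
  - by move=> x; rewrite ler01 lexx.
  - by move=> x; rewrite ler01 lexx.
by rewrite big_const_seq count_predT iter_addr addr0 mulr_natl.
Qed.

Lemma hom_ext k (w w' : 'I_k * 'I_k -> R * R -> R) :
  (forall p, p \in edges k -> w p = w' p) -> hom w = hom w'.
Proof.
move=> ww; rewrite /hom; congr iter_mean; apply/funext => x.
by rewrite /hom_integrand !big_seq; apply: eq_bigr => p pe; rewrite ww.
Qed.

Section closure.
Context (J : Type) (PJ : J -> Prop) (F : set_system nat) (FF : Filter F).
Variables (v : nat -> J -> R * R -> R) (v' : J -> R * R -> R).
Hypothesis bv : forall n j, PJ j -> bounded_meas (v n j).
Hypothesis bv' : forall j, PJ j -> bounded_meas (v' j).
Variable k : nat.
Hypothesis vv' : forall f : 'I_k * 'I_k -> J, (forall e, PJ (f e)) ->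
  hom (fun e => v n (f e)) @[n --> F] --> hom (fun e => v' (f e)).

(** The coefficients do not depend on [n]: the same combination is taken of [v n] and of [v']. The
    index set [J] with its predicate [PJ] serves both for codes of cells and for functions of the
    generating set. *)
Definition lin_comb (l : seq (R * J)) (u : J -> R * R -> R) (z : R * R) : R :=
  \sum_(c <- l) c.1 * u c.2 z.

(** Stated through [nth] because [J] is a bare type, without the decidable equality that list
    membership uses. *)
Definition all_PJ (l : seq (R * J)) := forall i d, (i < size l)%N -> PJ (nth d l i).2.

Lemma bounded_meas_lin_comb l (u : J -> R * R -> R) : (forall j, PJ j -> bounded_meas (u j)) ->
  all_PJ l -> bounded_meas (lin_comb l u).
Proof.
move=> bu; elim: l => [|c l IH] pl.
  by rewrite /lin_comb; under eq_fun do rewrite big_nil; exact: bounded_meas_cst.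
rewrite /lin_comb; under eq_fun do rewrite big_cons.
apply: bounded_measD; last by apply: IH => i d il; exact: (pl i.+1 d).
by apply/bounded_measZ/bu; exact: (pl 0 c).
Qed.

(** Multilinearity, one edge at a time: edges in [es1] carry combinations, those in [es2] single
    kernels chosen by [f]. Expanding the last edge of [es1] moves it to [es2], until [vv']
    applies. *)
Lemma hom_lin_comb_cvg (l : 'I_k * 'I_k -> seq (R * J)) : (forall e, all_PJ (l e)) ->
  (exists j, PJ j) ->
  hom (fun e => lin_comb (l e) (v n)) @[n --> F] --> hom (fun e => lin_comb (l e) v').
Proof.
move=> pl [j0 pj0].
pose H (es1 es2 : seq ('I_k * 'I_k)) (f : 'I_k * 'I_k -> J) (u : J -> R * R -> R) (x : nat -> R) :=
  (\prod_(e <- es1) lin_comb (l e) u (x e.1, x e.2)) * \prod_(e <- es2) u (f e) (x e.1, x e.2).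
pose T es1 es2 f u := iter_mean (rev (iota 0 k)) (H es1 es2 f u) (fun=> 0).
have nH es1 es2 f u : (forall j, PJ j -> bounded_meas (u j)) -> (forall e, PJ (f e)) ->
    nice (H es1 es2 f u).
  move=> bu pf; apply: niceM; apply: nice_prod => e; apply: nice_kernel.
    exact: bounded_meas_lin_comb.
  exact: bu.
suff main es1 es2 f : es1 ++ es2 = edges k -> (forall e, PJ (f e)) ->
    T es1 es2 f (v n) @[n --> F] --> T es1 es2 f v'.
  have TE u : T (edges k) [::] (fun=> j0) u = hom (fun e => lin_comb (l e) u).
    by congr iter_mean; apply/funext => x; rewrite /H big_nil mulr1.
  have := main (edges k) [::] (fun=> j0) (cats0 _) (fun=> pj0).
  by under eq_fun do rewrite TE; rewrite TE.
elim/last_ind: es1 es2 f => [|es1 e IH] es2 f es12 pf.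
  have TE u : T [::] es2 f u = hom (fun e => u (f e)).
    by congr iter_mean; apply/funext => x; rewrite /H big_nil mul1r /hom_integrand -es12.
  by under eq_fun do rewrite TE; rewrite TE; exact: vv'.
have ne1 : e \notin es2.
  have := edges_uniq k; rewrite -es12 cat_rcons cat_uniq /= => /and3P[_ _ /andP[]].
  by [].
pose fj j e' := if e' == e then j else f e'.
have pfj j : PJ j -> forall e', PJ (fj j e').
  by move=> pj e'; rewrite /fj; case: ifP.
have HE u x : H (rcons es1 e) es2 f u x =
    \sum_(c <- l e) c.1 * H es1 (e :: es2) (fj c.2) u x.
  rewrite /H -cats1 big_cat big_seq1 /= /lin_comb -mulrA big_distrl /= big_distrr /=.
  apply: eq_bigr => c _; rewrite big_cons {1}/fj eqxx.
  have -> : \prod_(j <- es2) u (fj c.2 j) (x j.1, x j.2) = \prod_(e' <- es2) u (f e') (x e'.1, x e'.2).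
    rewrite !big_seq; apply: eq_bigr => e' ee; rewrite /fj.
    by case: eqP => // eE; rewrite -eE ee in ne1.
  by ring.
have TE u : (forall j, PJ j -> bounded_meas (u j)) ->
    T (rcons es1 e) es2 f u = \sum_(c <- l e) c.1 * T es1 (e :: es2) (fj c.2) u.
  move=> bu; rewrite /T (_ : H (rcons es1 e) es2 f u =
    fun x => \sum_(c <- l e) c.1 * H es1 (e :: es2) (fj c.2) u x); last by apply/funext => x; exact: HE.
  elim: (l e) (pl e) => [|c le IHl] ple.
    by rewrite big_nil; under eq_fun do rewrite big_nil; exact: iter_mean0.
  rewrite big_cons; under eq_fun do rewrite big_cons.
  have pc : PJ c.2 by exact: (ple 0%N c).
  have ple' : all_PJ le by move=> i d il; exact: (ple i.+1 d).
  rewrite iter_meanD.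
  - by rewrite iter_meanZ ?IHl//; apply: nH => //; exact: pfj.
  - by apply: niceZ; apply: nH => //; exact: pfj.
  - elim: {IHl ple} le ple' => [|c' le' IHl'] ple.
      by under eq_fun do rewrite big_nil; exact: nice_cst.
    under eq_fun do rewrite big_cons; apply: niceD.
      by apply: niceZ; apply: nH => //; apply: pfj; exact: (ple 0%N c').
    by apply: IHl' => i d il; exact: (ple i.+1 d).
rewrite (TE _ bv') (_ : (fun n => T _ _ _ (v n)) = fun n =>
    \sum_(c <- l e) c.1 * T es1 (e :: es2) (fj c.2) (v n)); last first.
  by apply/funext => n; apply: TE; exact: bv.
elim: (l e) (pl e) => [|c le IHl] ple.
  by under eq_fun do rewrite big_nil; rewrite big_nil; exact: cvg_cst.
under eq_fun do rewrite big_cons; rewrite big_cons; apply: cvgD.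
  apply: cvgM; first exact: cvg_cst.
  apply: IH; first by rewrite -es12 cat_rcons.
  by apply: pfj; exact: (ple 0%N c).
by apply: IHl => i d il; exact: (ple i.+1 d).
Qed.

(** Along the sequence the approximation is uniform, but at the limit it holds only almost
    everywhere, and there the combination may exceed the bound on a null set. It is clipped to
    [-D, D], which changes no density. *)
Lemma hom_closure_cvg (g : nat -> 'I_k * 'I_k -> R * R -> R) (g' : 'I_k * 'I_k -> R * R -> R) C :
  (exists j, PJ j) ->
  (forall n e, bounded_meas (g n e)) -> (forall e, bounded_meas (g' e)) ->
  (forall n e z, `|g n e z| <= C) -> (forall e z, `|g' e z| <= C) ->
  (forall e d, 0 < d -> exists l : seq (R * J),
    [/\ all_PJ l, forall n z, `|g n e z - lin_comb l (v n) z| <= d &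
        {ae (@lebesgue_measure R \x @lebesgue_measure R)%E, forall z, (@I01 R `*` @I01 R) z ->
          `|g' e z - lin_comb l v' z| <= d}]) ->
  hom (g n) @[n --> F] --> hom g'.
Proof.
move=> exJ bg bg' gC gC' app; apply/cvgrPdist_le => e e0.
pose E := (size (edges k))%:R : R; have E0 : 0 <= E by rewrite ler0n.
(* A combination at distance at most 1 from a function bounded by [C] is bounded by [D]. *)
pose D := `|C| + 1; have D1 : 1 <= D by rewrite lerDr.
have CD : C <= D by rewrite (le_trans (ler_norm _))// lerDl.
pose M := D ^+ size (edges k) * E.
have M0 : 0 <= M by rewrite mulr_ge0// exprn_ge0// (le_trans ler01).
(* The 1 keeps the combinations below [D]; the quotient makes the three errors add up to at most
   [e]. *)
pose d := Num.min 1 (e / (2 * M + 1)).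
have d0 : 0 < d by rewrite lt_min ltr01 divr_gt0//; lra.
have d1 : d <= 1 by rewrite ge_min lexx.
have dM : M * d + d + M * d <= e.
  have : d <= e / (2 * M + 1) by rewrite /d ge_min lexx orbT.
  by rewrite ler_pdivlMr; [move=> h; apply: le_trans h; lra|lra].
have [l hl] := choice (fun a => app a d d0).
have CdD x : x <= C + d -> x <= D.
  by move=> h; apply: (le_trans h); apply: lerD => //; exact: ler_norm.
have blv n a : bounded_meas (lin_comb (l a) (v n)).
  by apply: bounded_meas_lin_comb => [j|]; [exact: bv|have [] := hl a].
have blv' a : bounded_meas (lin_comb (l a) v').
  by apply: bounded_meas_lin_comb => [j|]; [exact: bv'|have [] := hl a].
have D0 : 0 <= D by apply: le_trans D1.
have aeD a : {ae (@lebesgue_measure R \x @lebesgue_measure R)%E, forall z, (@I01 R `*` @I01 R) z ->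
    `|lin_comb (l a) v' z| <= D /\ `|g' a z - lin_comb (l a) v' z| <= d}.
  have [_ _] := hl a; apply: ae_square_imp => z h zI; split; last exact: h.
  apply: CdD; rewrite -[lin_comb _ _ _](subrK (g' a z)) (le_trans (ler_normD _ _))// addrC lerD// distrC.
  exact: h.
pose clip a z := Num.max (- D) (Num.min D (lin_comb (l a) v' z)).
have clipE a z : `|lin_comb (l a) v' z| <= D -> clip a z = lin_comb (l a) v' z.
  by rewrite ler_norml /clip => /andP[? ?]; rewrite min_r// max_r.
have clipD a z : `|clip a z| <= D.
  by rewrite ler_norml /clip le_max lexx /= ge_max ge_min lexx andbT lerNl (le_trans _ D0)// oppr_le0.
have bclip a : bounded_meas (clip a).
  split; last by exists D.
  apply: measurable_maxr; first exact: measurable_cst.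
  by apply: measurable_minr; [exact: measurable_cst|exact: (blv' a).1].
(* The clipped and unclipped combinations agree almost everywhere, so [hom_L1_le] applies with
   distance 0; [N] bounds both. *)
have hclip : hom clip = hom (fun a => lin_comb (l a) v').
  have [B hB] := choice (fun a => (blv' a).2).
  pose N := D + \sum_a `|B a|.
  have BN a : B a <= N.
    apply: le_trans (ler_norm _) _; rewrite /N (bigD1 a)//= addrCA lerDl addr_ge0//.
    by apply: sumr_ge0.
  have DN : D <= N by rewrite /N lerDl sumr_ge0.
  apply/eqP; rewrite -subr_eq0 -normr_le0.
  have := @hom_L1_le k clip (fun a => lin_comb (l a) v') N 0.
  rewrite !mulr0; apply => //.
  - exact: le_trans DN.
  - by move=> a z; exact: le_trans DN.
  - by move=> a z; apply: le_trans (BN a); exact: hB.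
  - move=> a; apply: mean2_ae_le => //; first exact: bounded_measB.
    apply: ae_square_imp (aeD a) => z h zI; have [hz _] := h zI.
    by rewrite clipE// subrr normr0.
have h' : `|hom g' - hom (fun a => lin_comb (l a) v')| <= M * d.
  rewrite -hclip /M -mulrA; apply: hom_L1_le => // [a z|a].
    exact: le_trans (gC' a z) CD.
  apply: mean2_ae_le; [exact: bounded_measB|exact: ltW|].
  apply: ae_square_imp (aeD a) => z h zI; have [hz gz] := h zI.
  by rewrite clipE.
have hn n : `|hom (g n) - hom (fun a => lin_comb (l a) (v n))| <= M * d.
  rewrite /M -mulrA; apply: hom_L1_le => // [a z|a z|a].
  - exact: le_trans (gC n a z) CD.
  - have [_ h _] := hl a; apply: CdD.
    rewrite -[lin_comb _ _ _](subrK (g n a z)) (le_trans (ler_normD _ _))// addrC lerD// distrC.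
    exact: h.
  - have [_ h _] := hl a; apply: le_trans (ler_norm _) _.
    apply: mean2_norm_le; first by apply/bounded_meas_norm/bounded_measB.
    by move=> z; rewrite normr_id; exact: h.
have pl a : all_PJ (l a) by have [] := hl a.
have := hom_lin_comb_cvg pl exJ => /cvgrPdist_le /(_ d d0); apply: filterS => n hmid.
apply: le_trans dM; apply: le_trans (ler_distD (hom (fun a => lin_comb (l a) (v n))) _ _) _.
rewrite [X in _ + X <= _]distrC; apply: lerD => //.
apply: le_trans (ler_distD (hom (fun a => lin_comb (l a) v')) _ _) _.
exact: lerD.
Qed.

End closure.

End Multilinear.

(** * The tree of cells and the limit graphon *)

Section Cells.
Context {R : realType} (K : ptopologicalType).
Hypotheses (hcomp : compact [set: K]) (hhaus : hausdorff_space K).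
Variable V : nat -> set K.
Hypotheses (Vopen : forall i, open (V i))
  (Vbase : forall x O, nbhs x O -> exists2 i, V i x & V i `<=` O).

Definition kbit (x : K) i : bool := `[< V i x >].

Definition cell (s : seq bool) : set K := [set x | mkseq (kbit x) (size s) = s].

Lemma cell_rcons s b :
  cell (rcons s b) = cell s `&` (if b then V (size s) else ~` V (size s)).
Proof.
apply/seteqP; split => x; rewrite /cell /= size_rcons mkseqS.
  move/rcons_inj => [-> <-]; split => //; rewrite /kbit.
  by case: (pselect (V (size s) x)) => Vx; [rewrite asboolT|rewrite asboolF].
move=> [-> h]; congr rcons; rewrite /kbit.
by case: b h => h; [rewrite asboolT|rewrite asboolF].
Qed.

Lemma measurable_cell s : measurable (cell s : set (borelK K)).
Proof.
elim/last_ind: s => [|s b IH].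
  by rewrite (_ : cell [::] = setT)//; apply/seteqP; split.
rewrite cell_rcons; apply: measurableI => //.
have mV : measurable (V (size s) : set (borelK K)) by apply: sub_sigma_algebra; exact: Vopen.
by case: b => //; exact: measurableC.
Qed.

Lemma cell_cat s x N : cell s x -> (N <= size s)%N -> cell (take N s) x.
Proof.
move=> sx Ns; have sE : mkseq (kbit x) (size s) = s := sx.
rewrite /cell /= size_takel// -[in RHS]sE.
apply: (@eq_from_nth _ false) => [|i]; rewrite size_mkseq ?size_takel ?size_mkseq// => iN.
by rewrite nth_take// !nth_mkseq// (leq_trans iN).
Qed.

(** Were it false at every depth, the first points of violating pairs would cluster at some [p]. A
    basic set [V i] around [p] on which [f] is within [e / 2] of [f p] contains the first point of a
    pair agreeing beyond bit [i], hence also the second. *)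
Lemma cell_oscillation (f : K -> R) e : continuous f -> 0 < e ->
  exists N, forall x y, mkseq (kbit x) N = mkseq (kbit y) N -> `|f x - f y| <= e.
Proof.
move=> cf e0; apply: contrapT => /forallNP H.
have /choice[xy hxy] : forall N, exists xy : K * K,
    mkseq (kbit xy.1) N = mkseq (kbit xy.2) N /\ e < `|f xy.1 - f xy.2|.
  move=> N; have /existsNP[x /existsNP[y /not_implyP[xy /negP]]] := H N.
  by rewrite -ltNge => h; exists (x, y).
have [|p [_ clp]] := hcomp (F := (xy n).1 @[n --> \oo]); first exact: filterT.
have nb : nbhs p [set y | `|f p - f y| <= e / 2].
  by have /cvgrPdist_le := cf p; apply; rewrite divr_gt0.
have [i Vp VO] := Vbase nb.
have [|_ [[N iN <-] /= Vx]] := clp [set (xy n).1 | n in [set n | (i < n)%N]] (V i) _ (open_nbhs_nbhs (conj (Vopen i) Vp)).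
  by exists i.+1 => // n /= ni; exists n.
have [xyN] := hxy N; apply/negP; rewrite -leNgt.
have Vy : V i (xy N).2.
  have := congr1 (nth false ^~ i) xyN; rewrite !nth_mkseq// /kbit (asboolT Vx).
  by move=> /esym /asboolP.
rewrite -(subrK (f p) (f (xy N).1)) -addrA (le_trans (ler_normD _ _))//.
rewrite [leRHS](splitr e) lerD//; first by rewrite distrC; exact: VO.
exact: VO.
Qed.

(** An arbitrary sample point; for an empty cell it is a default value, which enters sums with
    weight zero. *)
Definition cell_point s : K := get (cell s).

Lemma cell_pointP s x : cell s x -> cell s (cell_point s).
Proof. by move=> sx; apply: (getPex (P := cell s)); exists x. Qed.

Definition valid (b : nat -> bool) := forall N, cell (mkseq b N) !=set0.

(* [point] is a dummy value on branches with an empty cell, which carry no mass. *)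
Definition branch_point (b : nat -> bool) : K :=
  if pselect (valid b) then get (\bigcap_N closure (cell (mkseq b N))) else point.

(** Cells need not be closed, so compactness yields only a point of all their closures: a cluster
    point of the filter that the nested cells generate. *)
Lemma branch_pointP b N : valid b -> closure (cell (mkseq b N)) (branch_point b).
Proof.
move=> vb; rewrite /branch_point; case: (pselect (valid b)) => [vb'|//].
suff [p hp] : \bigcap_N closure (cell (mkseq b N)) !=set0.
  by have := getPex (P := \bigcap_N closure (cell (mkseq b N))) (ex_intro _ p hp); apply.
pose F : set_system K := filter_from setT (fun N => cell (mkseq b N)).
have decr M M' : (M <= M')%N -> cell (mkseq b M') `<=` cell (mkseq b M).
  move=> MM x /(@cell_cat _ _ M); rewrite size_mkseq => /(_ MM).
  suff -> : take M (mkseq b M') = mkseq b M by [].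
  apply: (@eq_from_nth _ false) => [|i]; rewrite ?size_takel ?size_mkseq// => iM.
  by rewrite nth_take// !nth_mkseq// (leq_trans iM).
have FF : ProperFilter F.
  apply: filter_from_proper; last by move=> M _; exact: vb.
  apply: filter_from_filter; first by exists 0%N.
  move=> i j _ _; exists (maxn i j) => // x h; split; apply: decr h.
    exact: leq_maxl.
  exact: leq_maxr.
have [|p [_ clp]] := hcomp FF; first by exists 0%N.
exists p => M _; move: clp; rewrite clusterE => /(_ (cell (mkseq b M))); apply.
by exists M.
Qed.

(** Regularity gives a basic set [V i] around the point with closure inside [O]. Bit [i] must be
    [true], for otherwise the open set [V i] would miss a cell having the point in its closure; so
    the cell of length [i.+1] lies in [V i]. *)
Lemma branch_point_open b (O : set K) : valid b -> open O ->
  O (branch_point b) <-> exists N, closure (cell (mkseq b N)) `<=` O.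
Proof.
move=> vb oO; split => [Op|[N NO]]; last by apply: NO; exact: branch_pointP.
have nO : nbhs (branch_point b) O by exact: open_nbhs_nbhs.
have [D nD DO] := compact_regular hhaus hcomp (filterT : nbhs (branch_point b) setT) nO.
have [i Vp VD] := Vbase nD.
exists i.+1; apply: subset_trans DO; apply: closure_subset.
have bi : b i.
  apply: contrapT => /negP/negbTE bi.
  have [x []] := branch_pointP i.+1 vb (open_nbhs_nbhs (conj (Vopen i) Vp)).
  by rewrite mkseqS bi cell_rcons size_mkseq => -[].
by apply: subset_trans VD; rewrite mkseqS bi cell_rcons size_mkseq => x [].
Qed.

Lemma bigcup_seq_measurable d (T : measurableType d) (Q : seq bool -> Prop) (E : seq bool -> set T) :
  (forall s, measurable (E s)) -> measurable (\bigcup_(s in [set s | Q s]) E s).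
Proof.
move=> mE; pose G n : set T := if @unpickle (seq bool) n is Some s then
  (if pselect (Q s) then E s else set0) else set0.
have mG n : measurable (G n).
  by rewrite /G; case: (@unpickle (seq bool) n) => [s|]; [case: (is_left _)|].
rewrite (_ : \bigcup_(s in _) _ = \bigcup_n G n); first exact: bigcupT_measurable.
apply/seteqP; split => [x [s /= Qs Ex]|x [n _]]; rewrite /G.
  by exists (pickle s) => //; rewrite pickleK; case: (pselect (Q s)).
by case: (@unpickle (seq bool) n) => [s|//]; case: (pselect (Q s)) => // Qs Ex; exists s.
Qed.

(** Invalidity of a branch and, on valid branches, membership of the point in an open set are
    witnessed by finite prefixes, which are countable; on invalid branches the point is constant. *)
Lemma measurable_branch_point d (T : measurableType d) (b : T -> nat -> bool) :
  (forall s, measurable [set z | mkseq (b z) (size s) = s]) ->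
  measurable_fun setT (fun z => branch_point (b z) : borelK K).
Proof.
move=> mb; pose E s := [set z | mkseq (b z) (size s) = s].
pose Inv := \bigcup_(s in [set s | cell s = set0]) E s.
have mInv : measurable Inv by exact: bigcup_seq_measurable.
have InvP z : Inv z <-> ~ valid (b z).
  split => [[s /= s0 sz] vb|].
    by have [x] := vb (size s); rewrite sz s0.
  move=> /existsNP[N /set0P/negP/negPn/eqP N0]; exists (mkseq (b z) N) => //.
  by rewrite /E /= size_mkseq.
apply: (@measurability _ _ T (borelK K) setT (fun z => branch_point (b z)) (@open K)) => [//|_ [B oB <-]]; rewrite setTI.
rewrite (_ : _ @^-1` B = (\bigcup_(s in [set s | closure (cell s) `<=` B]) E s `\` Inv) `|`
    (Inv `&` (if pselect (B point) then setT else set0))).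
  apply: measurableU.
    by apply: measurableD => //; exact: bigcup_seq_measurable.
  by apply: measurableI => //; case: (is_left _).
apply/seteqP; split => z /=.
  have [vz|nvz] := pselect (valid (b z)).
    move=> /(branch_point_open vz oB)[N NB]; left; split; last by move/InvP.
    by exists (mkseq (b z) N) => //; rewrite /E /= size_mkseq.
  move=> Bz; right; split; first exact/InvP.
  by move: Bz; rewrite /branch_point; case: (pselect (valid (b z))) => // ?; case: (pselect (B point)).
case=> [[[s /= sB sz] nInv]|[/InvP nvz]].
  have vz : valid (b z) by apply: contrapT => /InvP.
  by apply/(branch_point_open vz oB); exists (size s); rewrite sz.
by case: (pselect (B point)) => // Op _; rewrite /branch_point; case: (pselect (valid (b z))).
Qed.

(** The branch point lies only in the closure of the cell, to which the oscillation bound extends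
    because it defines a closed set. *)
Lemma branch_point_near (f : K -> R) N e b : continuous f ->
  (forall x y, mkseq (kbit x) N = mkseq (kbit y) N -> `|f x - f y| <= e) ->
  valid b -> `|f (branch_point b) - f (cell_point (mkseq b N))| <= e.
Proof.
move=> cf osc vb; set q := cell_point _.
have cl : closed [set y | `|f y - f q| <= e].
  have cg : continuous (fun y => `|f y - f q|).
    move=> y; apply: (@continuous_comp _ _ _ (fun y => f y - f q) (fun r => `|r|)).
      by apply: cvgB; [exact: cf|exact: cvg_cst].
    exact: norm_continuous.
  rewrite (_ : [set y | _] = (fun y => `|f y - f q|) @^-1` [set r | r <= e])//.
  by apply: closed_comp => [y _|]; [exact: cg|exact: closed_le].
have [x Nx] := vb N.
have sub : cell (mkseq b N) `<=` [set y | `|f y - f q| <= e].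
  move=> y Ny /=; apply: osc; have := cell_pointP Ny; move: Ny.
  by rewrite /cell /= size_mkseq => -> ->.
by have := closure_subset sub (branch_pointP N vb); rewrite -(closure_id _).1.
Qed.

End Cells.

(** * Laws of random points of [K] and their dependence on a parameter *)

Section Law.
Context {R : realType} (K : ptopologicalType).

(* The Dirac mass is a dummy value for non-measurable [X]. *)
Definition law (X : measurableTypeR R -> borelK K) : PK R K :=
  if pselect (measurable_fun setT X) is left mX
  then (distribution unif (mfun_Sub (mem_set mX)) : probability (borelK K) R)
  else (dirac (point : borelK K) : probability (borelK K) R).

Lemma Rintegral_law (X : R -> borelK K) (f : borelK K -> R) :
  measurable_fun setT X -> bounded_meas f ->
  Rintegral (law X : probability (borelK K) R) setT f = mean1 (f \o X).
Proof.
move=> mX bf; have [mf [C hC]] := bf.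
have mX' : measurable_fun (setT : set (measurableTypeR R)) X by exact: mX.
have bfX : bounded_meas (f \o X) by exact: bounded_meas_comp.
have bX : bounded_meas (fun t => f (X t) + C) by apply: bounded_measD => //; exact: bounded_meas_cst.
have bfC : bounded_meas (fun x => f x + C) by apply: bounded_measD => //; exact: bounded_meas_cst.
have fC0 x : 0 <= f x + C by have := hC x; rewrite ler_norml => /andP[]; lra.
have P1 : (law X : probability (borelK K) R) setT = 1%E by exact: probability_setT.
have -> : Rintegral (law X : probability (borelK K) R) setT f =
    Rintegral (law X : probability (borelK K) R) setT (fun x => f x + C) - C.
  rewrite (@meanD _ _ _ (law X : probability (borelK K) R) setT measurableT P1)//; last exact: bounded_meas_cst.
  by rewrite (@mean_cst _ _ _ (law X : probability (borelK K) R) setT measurableT P1) addrK.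
have -> : mean1 (f \o X) = mean1 (fun t => f (X t) + C) - C.
  by rewrite mean1D ?mean1_cst ?addrK//; exact: bounded_meas_cst.
congr (_ - _); rewrite /Rintegral /law; case: pselect => // {}mX'.
rewrite ge0_integral_distribution/=.
- by rewrite (integral_unif_ge0 bX).
- by apply/measurable_EFinP; exact: bfC.1.
- by move=> y; rewrite lee_fin.
Qed.

Lemma law_measureE (X : R -> borelK K) (A : set (borelK K)) :
  measurable_fun setT X -> measurable A ->
  (law X : probability (borelK K) R) A = (mean1 (\1_A \o X))%:E.
Proof.
move=> mX mA; rewrite -(Rintegral_law mX (bounded_meas_indic mA)).
rewrite /Rintegral integral_indic// setIT fineK//.
exact: fin_num_measure.
Qed.

Lemma measurable_slice d (T : measurableType d) d' (Y : measurableType d') (X : T * R -> Y) z :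
  measurable_fun setT X -> measurable_fun setT (fun t => X (z, t)).
Proof. by move=> mX; apply: (measurableT_comp mX); exact: pair1_measurable. Qed.

(** The sigma-algebra of [PK] is generated by the sets of measures giving [A] mass less than [r];
    their preimages are sublevel sets of a partial integral. *)
Lemma measurable_law d (T : measurableType d) (X : T * R -> borelK K) :
  measurable_fun setT X -> measurable_fun setT (fun z => law (fun t => X (z, t))).
Proof.
move=> mX.
have mXz z : measurable_fun setT (fun t => X (z, t)) by exact: measurable_slice.
apply: (@measurability _ _ T (PK R K) setT _ (@pset _ (borelK K) R)) => [//|_ [_ [r r01 [A mA <-]] <-]].
rewrite setTI.
have bA : bounded_meas (fun z => mean1 (fun t => \1_A (X (z, t)) : R)).
  apply: (bounded_meas_mean1 (G := fun p => \1_A (X p))).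
  exact: (bounded_meas_comp (bounded_meas_indic mA) mX).
rewrite (_ : _ @^-1` _ = [set z | mean1 (fun t => \1_A (X (z, t)) : R) < r]).
  rewrite -[X in measurable X]setTI; apply: (measurable_fun_ltr bA.1) => //.
by apply/seteqP; split => z /=; rewrite /mset /= (law_measureE (mXz z) mA) lte_fin.
Qed.

Lemma measurable_PK_eval (A : set (borelK K)) : measurable A ->
  measurable_fun setT (fun mu : PK R K => (mu : probability (borelK K) R) A).
Proof.
by move=> mA; exact: (measurable_kernel (kprobability (@measurable_id _ (PK R K) setT)) A mA).
Qed.

Lemma measurable_continuous (f : K -> R) : continuous f ->
  measurable_fun setT (f : borelK K -> R).
Proof.
move=> cf; apply: (measurability _ (RGenOInfty.measurableE R)) => // _ [_ [a ->] <-].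
rewrite setTI; apply: sub_sigma_algebra.
by move/continuousP : cf; apply; exact: interval_open.
Qed.

End Law.

(** * From cell masses to a graphon *)

Section Graphon.
Context {R : realType} {K : ptopologicalType}.
Hypotheses (hcomp : compact [set: K]) (hhaus : hausdorff_space K).
Variable V : nat -> set K.
Hypotheses (Vopen : forall i, open (V i))
  (Vbase : forall x O, nbhs x O -> exists2 i, V i x & V i `<=` O).
Implicit Types (W : R * R -> PK R K) (f : K -> R) (s : seq bool).
Local Notation I := (@I01 R).
Local Notation leb := (@lebesgue_measure R).
Local Notation pr mu := (mu : probability (borelK K) R).

Lemma ae_interval_imp (P Q : R -> Prop) : (forall t, P t -> Q t) ->
  {ae leb, forall t, P t} -> {ae leb, forall t, Q t}.
Proof. exact: (@filterS _ _ (@ae_filter_ringOfSetsType _ _ _ leb)). Qed.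

Lemma bounded_continuous f : continuous f -> bounded_meas (f : borelK K -> R).
Proof.
move=> cf; split; first exact: measurable_continuous.
have : compact [set f x | x in setT].
  by apply: continuous_compact => //; apply: continuous_subspaceT.
move=> /compact_bounded[M [_ /(_ (M + 1))]] H.
exists (M + 1) => x; apply: H; first by rewrite ltrDl.
by exists x.
Qed.

Lemma measurable_integral f : continuous f ->
  measurable_fun setT (fun mu : PK R K => Rintegral (pr mu) setT f).
Proof.
move=> cf; have bf := bounded_continuous cf; have [_ [C hC]] := bf.
have bC : bounded_meas (cst C : borelK K -> R) by exact: bounded_meas_cst.
have bfC : bounded_meas (fun x : borelK K => f x + C) by exact: bounded_measD.
rewrite (_ : (fun _ => _) = fun mu => Rintegral (pr mu) setT (fun x => f x + C) - C); last first.
  apply/funext => mu; have P1 : (pr mu) setT = 1%E by exact: probability_setT.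
  rewrite (@meanD _ _ _ (pr mu) setT measurableT P1 _ _ bf bC).
  by rewrite (@mean_cst _ _ _ (pr mu) setT measurableT P1) addrK.
apply: measurable_funB; last exact: measurable_cst.
apply: measurableT_comp; first exact: fine_measurable.
apply: (@measurable_fun_integral_kernel _ _ (PK R K) (borelK K) R (fun mu => pr mu)) => //.
- by move=> A mA; exact: measurable_PK_eval.
- by move=> x; rewrite lee_fin; have := hC x; rewrite ler_norml => /andP[]; lra.
- by apply/measurable_EFinP; exact: bfC.1.
Qed.

(** A Riemann sum over the cells of length [N]. Being linear in [p], it is a combination of cell
    kernels with coefficients depending on [f] only. *)
Definition cell_sum f N (p : seq bool -> R) : R :=
  \sum_(s : N.-tuple bool) f (cell_point V s) * p s.

Lemma integral_cell_sum (mu : PK R K) f N e : continuous f ->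
  (forall x y, mkseq (kbit V x) N = mkseq (kbit V y) N -> `|f x - f y| <= e) ->
  `|Rintegral (pr mu) setT f - cell_sum f N (fun s => fine ((pr mu) (cell V s)))| <= e.
Proof.
move=> cf osc; have bf := bounded_continuous cf.
have P1 : (pr mu) setT = 1%E by exact: probability_setT.
have mc s : measurable (cell V s : set (borelK K)) by exact: measurable_cell.
pose g (x : borelK K) := \sum_(s : N.-tuple bool) f (cell_point V s) * \1_(cell V s) x.
have bi s : bounded_meas (\1_(cell V s) : borelK K -> R) by exact: bounded_meas_indic.
have bs s : bounded_meas (fun x : borelK K => f (cell_point V s) * \1_(cell V s) x).
  exact: bounded_measZ.
have bg : bounded_meas g by apply: bounded_meas_sum => s; exact: bs.
have gE x : g x = f (cell_point V (mkseq (kbit V x) N)).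
  have xb : cell V (bits (kbit V x) N) x by rewrite /cell /= size_mkseq.
  rewrite /g (bigD1 (bits (kbit V x) N))//= indicE (mem_set xb) mulr1.
  rewrite big1 ?addr0// => s sx; rewrite indicE memNset ?mulr0//= => xs.
  move/eqP : sx; apply; apply/val_inj.
  by move: xs; rewrite /cell /= size_tuple => ->.
have -> : cell_sum f N (fun s => fine ((pr mu) (cell V s))) = Rintegral (pr mu) setT g.
  rewrite (@mean_sum _ _ _ (pr mu) setT measurableT P1 _ _ _ _ (fun s : N.-tuple bool => bs s)).
  apply: eq_bigr => s _.
  rewrite (@meanZ _ _ _ (pr mu) setT measurableT P1 _ _ (bi s)).
  by rewrite /Rintegral integral_indic// setIT.
rewrite -(@meanB _ _ _ (pr mu) setT measurableT P1 _ _ bf bg).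
apply: (@mean_norm_le _ _ _ (pr mu) setT measurableT P1).
  exact: bounded_measB.
move=> x _; rewrite gE; apply: osc.
have : cell V (mkseq (kbit V x) N) x by rewrite /cell /= size_mkseq.
by move/cell_pointP; rewrite /cell /= size_mkseq => ->.
Qed.

(** Cut off outside the unit square, where a graphon is unconstrained, so that the kernel is
    measurable and symmetric everywhere. *)
Definition wcell W s : R * R -> R := (fun z => fine ((pr (W z)) (cell V s))) \_ (I `*` I).

Definition wf W f : R * R -> R := (fun z => Wf W f z.1 z.2) \_ (I `*` I).

Lemma wcellE W s z : (I `*` I) z -> wcell W s z = fine ((pr (W z)) (cell V s)).
Proof. by move=> Iz; rewrite /wcell /patch mem_set. Qed.

Lemma wcell_out W s z : ~ (I `*` I) z -> wcell W s z = 0.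
Proof. by move=> Iz; rewrite /wcell /patch memNset. Qed.

Lemma wfE W f z : (I `*` I) z -> wf W f z = Rintegral (pr (W z)) setT f.
Proof. by move=> Iz; rewrite /wf /patch mem_set// /Wf -surjective_pairing. Qed.

Lemma wf_out W f z : ~ (I `*` I) z -> wf W f z = 0.
Proof. by move=> Iz; rewrite /wf /patch memNset. Qed.

Lemma fine_prob01 (mu : PK R K) s : 0 <= fine ((pr mu) (cell V s)) <= 1.
Proof.
have mc : measurable (cell V s : set (borelK K)) by exact: measurable_cell.
by rewrite fine_ge0//= -lee_fin fineK ?probability_le1//; exact: fin_num_measure.
Qed.

Lemma kernel_wcell W s : Kgraphon W -> kernel (wcell W s).
Proof.
move=> [mW _]; split.
  apply: (@bounded_meas_restrict _ _ _ _ _ 1) => //.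
  - exact: measurable_I01X.
  - apply: (@measurable_comp _ _ _ _ _ _ setT (fun mu : PK R K => fine ((pr mu) (cell V s)))) => //.
    apply: measurableT_comp; first exact: fine_measurable.
    by apply: measurable_PK_eval; exact: measurable_cell.
  - by move=> z _; have /andP[h0 h1] := fine_prob01 (W z) s; rewrite ger0_norm.
move=> z; have [Iz|Iz] := pselect ((I `*` I) z); last by rewrite wcell_out// lexx ler01.
by rewrite wcellE//; exact: fine_prob01.
Qed.

Lemma wcell_sym W s x y : Kgraphon W -> wcell W s (x, y) = wcell W s (y, x).
Proof.
move=> [_ sW]; have [[Ix Iy]|nI] := pselect ((I `*` I) (x, y)).
  rewrite (@wcellE _ _ (x, y) (conj Ix Iy)) (@wcellE _ _ (y, x) (conj Iy Ix)).
  by rewrite (sW x y Ix Iy).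
by rewrite !wcell_out// => -[Iy Ix]; apply: nI; exact: (conj Ix Iy).
Qed.

Lemma wcell_split W s z :
  wcell W s z = wcell W (rcons s false) z + wcell W (rcons s true) z.
Proof.
have [Iz|Iz] := pselect ((I `*` I) z); last by rewrite !wcell_out// addr0.
rewrite !wcellE//.
have mc t : measurable (cell V t : set (borelK K)) by exact: measurable_cell.
rewrite -fineD; try exact: fin_num_measure.
congr fine; rewrite -measureU//; first congr (_ _).
  by rewrite !cell_rcons -setIUr setUC setUv setIT.
by rewrite !cell_rcons setIACA setICl !setI0.
Qed.

Lemma wcell_nil W z : (I `*` I) z -> wcell W [::] z = 1.
Proof.
move=> Iz; rewrite wcellE// (_ : cell V [::] = setT) ?probability_setT//.
by apply/seteqP; split.
Qed.

Lemma wcell_empty W s z : cell V s = set0 -> wcell W s z = 0.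
Proof.
move=> s0; have [Iz|Iz] := pselect ((I `*` I) z); last by rewrite wcell_out.
by rewrite wcellE// s0 measure0.
Qed.

Lemma wf_norm_le W f C z : continuous f -> 0 <= C -> (forall x, `|f x| <= C) -> `|wf W f z| <= C.
Proof.
move=> cf C0 hC; have [Iz|Iz] := pselect ((I `*` I) z); last by rewrite wf_out// normr0.
rewrite wfE//; have P1 : (pr (W z)) setT = 1%E by exact: probability_setT.
apply: (@mean_norm_le _ _ _ (pr (W z)) setT measurableT P1) => //.
exact: bounded_continuous.
Qed.

Lemma bounded_meas_wf W f : Kgraphon W -> continuous f -> bounded_meas (wf W f).
Proof.
move=> [mW _] cf; have [_ [C hC]] := bounded_continuous cf.
have C0 : 0 <= C by apply: le_trans (hC point).
apply: (@bounded_meas_restrict _ _ _ _ _ C) => //.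
- exact: measurable_I01X.
- rewrite (_ : (fun _ => _) = (fun mu : PK R K => Rintegral (pr mu) setT f) \o W).
    by apply: (@measurable_comp _ _ _ _ _ _ setT) => //; exact: measurable_integral.
  by apply/funext => z; rewrite /Wf -surjective_pairing.
- by move=> z Iz; have := wf_norm_le W z cf C0 hC; rewrite /wf /patch mem_set.
Qed.

Lemma wf_cell_sum W f N e z : continuous f -> 0 <= e ->
  (forall x y, mkseq (kbit V x) N = mkseq (kbit V y) N -> `|f x - f y| <= e) ->
  `|wf W f z - cell_sum f N (fun s => wcell W s z)| <= e.
Proof.
move=> cf e0 osc; have [Iz|Iz] := pselect ((I `*` I) z).
  rewrite wfE//; have -> : (fun s => wcell W s z) = fun s => fine ((pr (W z)) (cell V s)).
    by apply/funext => s; rewrite wcellE.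
  exact: integral_cell_sum.
rewrite wf_out// /cell_sum big1 ?subrr ?normr0// => s _.
by rewrite wcell_out// mulr0.
Qed.

Section tree.
Variable p : seq bool -> R.
Hypotheses (p_ge0 : forall s, 0 <= p s) (p_nil : p [::] = 1).
Hypothesis p_split : forall s, p s = p (rcons s false) + p (rcons s true).
Hypothesis p_empty : forall s, cell V s = set0 -> p s = 0.

(** An empty cell has mass zero, so the points whose code names it form a null set, and there are
    countably many cells. *)
Lemma ae_valid : {ae leb, forall t, I t -> valid V (ibit p t)}.
Proof.
have H n : {ae leb, forall t, I t -> forall s, @unpickle (seq bool) n = Some s ->
    cell V s = set0 -> mkseq (ibit p t) (size s) <> s}.
  case: (@unpickle (seq bool) n) => [s|]; last by apply: aeW => t _ s.
  have [s0|s0] := pselect (cell V s = set0); last by apply: aeW => t _ _ [<-].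
  have ml := measurable_ibit p (in_tuple s).
  have m0 : mean1 (\1_[set t | bits (ibit p t) (size s) = in_tuple s]) = 0.
    rewrite -[RHS](p_empty s0) -[s in RHS]/(tval (in_tuple s)).
    rewrite -(level_mass_icode p_ge0 p_nil p_split (in_tuple s)) /level_mass.
    congr mean1; apply/funext => t; rewrite indicE /level_indic; congr (_%:R); congr nat_of_bool.
    by apply/idP/eqP; rewrite inE.
  apply: ae_interval_imp (ae_notin_mean1 ml m0) => t /[apply] nt s' [<-] _ ts.
  by apply: nt; apply/val_inj.
apply: ae_interval_imp (ae_foralln H) => t Ht It N; apply/set0P/negP => /eqP N0.
by apply: (Ht (pickle (mkseq (ibit p t) N)) It _ (pickleK _) N0); rewrite size_mkseq.
Qed.

(** The Riemann sum is the mean over [t] of [f] at the sample point of the prefix of length [N],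
    which for almost every [t] is [e]-close to [f] at the branch point. *)
Lemma law_cell_sum f N e : continuous f -> 0 <= e ->
  measurable_fun setT (fun t => branch_point V (ibit p t) : borelK K) ->
  (forall x y, mkseq (kbit V x) N = mkseq (kbit V y) N -> `|f x - f y| <= e) ->
  `|Rintegral (pr (law (fun t => branch_point V (ibit p t)))) setT f - cell_sum f N p| <= e.
Proof.
move=> cf e0 mX osc; have bf := bounded_continuous cf.
have ml := @measurable_ibit _ p N.
rewrite (Rintegral_law mX bf).
have bfX : bounded_meas (fun t => f (branch_point V (ibit p t))) by exact: (bounded_meas_comp bf mX).
pose h (s : N.-tuple bool) := f (cell_point V s).
have bh : bounded_meas (fun t => h (bits (ibit p t) N)) by exact: bounded_meas_level.
have -> : cell_sum f N p = mean1 (fun t => h (bits (ibit p t) N)).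
  rewrite (mean1_level ml h); apply: eq_bigr => s _.
  by rewrite (level_mass_icode p_ge0 p_nil p_split) mulrC.
rewrite -(mean1B bfX bh); apply: mean1_ae_le => //; first exact: bounded_measB.
apply: ae_interval_imp ae_valid => t /[apply] vt.
exact: branch_point_near.
Qed.

End tree.

Section limit.
Variable u : seq bool -> R * R -> R.
Hypotheses (ku : forall s, kernel (u s)) (su : forall s x y, u s (x, y) = u s (y, x)).

(** A probability measure even where [u] fails to be a tree of masses, so measurability and symmetry
    need no exceptional set. *)
Definition tree_graphon (z : R * R) : PK R K :=
  law (fun t => branch_point V (ibit (u ^~ z) t)).

Lemma measurable_tree_point :
  measurable_fun setT (fun zt : (R * R) * R => branch_point V (ibit (u ^~ zt.1) zt.2) : borelK K).
Proof.
apply: (measurable_branch_point hcomp hhaus Vopen Vbase) => s.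
have := @measurable_icode _ _ _ (fun z : R * R => u ^~ z) s (fun s => (ku s).1.1).
by congr measurable; apply/seteqP; split => z /=; rewrite icodeE.
Qed.

Lemma Kgraphon_tree : Kgraphon tree_graphon.
Proof.
split; last first.
  move=> x y _ _; rewrite /tree_graphon; suff -> : u ^~ (x, y) = u ^~ (y, x) by [].
  by apply/funext => s; exact: su.
apply: measurable_funTS.
exact: (measurable_law measurable_tree_point).
Qed.

Lemma tree_graphon_cell_sum f N e z : continuous f -> 0 <= e -> (I `*` I) z ->
  u [::] z = 1 -> (forall s, u s z = u (rcons s false) z + u (rcons s true) z) ->
  (forall s, cell V s = set0 -> u s z = 0) ->
  (forall x y, mkseq (kbit V x) N = mkseq (kbit V y) N -> `|f x - f y| <= e) ->
  `|wf tree_graphon f z - cell_sum f N (u ^~ z)| <= e.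
Proof.
move=> cf e0 Iz un us ue osc; rewrite wfE//.
apply: law_cell_sum => //.
  by move=> s; have /andP[] := (ku s).2 z.
exact: (measurable_slice z measurable_tree_point).
Qed.

End limit.

Theorem graphon_compactness (U : set_system nat) (UU : UltraFilter U) (W : nat -> R * R -> PK R K) :
  (forall n, Kgraphon (W n)) ->
  exists2 W0, Kgraphon W0 &
    forall k (f : 'I_k * 'I_k -> K -> R), (forall e, continuous (f e)) ->
      hom (fun e => wf (W n) (f e)) @[n --> U] --> hom (fun e => wf W0 (f e)).
Proof.
move=> gW.
(* Cells are enumerated by their codes; numbers that code no cell get the zero kernel. *)
pose w n r := if @unpickle (seq bool) r is Some s then wcell (W n) s else fun=> 0.
have wE n s : w n (pickle s) = wcell (W n) s by rewrite /w pickleK.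
have kw n r : kernel (w n r).
  rewrite /w; case: unpickle => [s|]; first exact: kernel_wcell.
  by split; [exact: bounded_meas_cst|move=> z; rewrite lexx ler01].
have sw n r x y : w n r (x, y) = w n r (y, x).
  by rewrite /w; case: unpickle => // s; exact: wcell_sym.
have [u [ku su cu aeu]] := kernel_compactness UU kw sw.
pose u' s := u (pickle s : nat).
have ku' s : kernel (u' s) by exact: ku.
have su' s x y : u' s (x, y) = u' s (y, x) by exact: su.
exists (tree_graphon u'); first exact: Kgraphon_tree.
move=> k f cf.
have /choice[C hC] : forall e, exists C, 0 <= C /\ forall x, `|f e x| <= C.
  move=> e; have [_ [C hC]] := bounded_continuous (cf e); exists C; split => //.
  by apply: le_trans (hC point).
pose M := \sum_e C e.
have CM e x : `|f e x| <= M.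
  apply: le_trans ((hC e).2 x) _; rewrite /M (bigD1 e)//= lerDl sumr_ge0// => i _.
  exact: (hC i).1.
have M0 : 0 <= M by apply: sumr_ge0 => e _; exact: (hC e).1.
apply: (@hom_closure_cvg _ nat (fun=> True) U _ w u _ _ k _ _ _ M).
- by move=> n j _; exact: (kw n j).1.
- by move=> j _; exact: (ku j).1.
- by move=> f' _; exact: cu.
- by exists 0%N.
- by move=> n e; exact: bounded_meas_wf.
- by move=> e; apply: bounded_meas_wf => //; exact: Kgraphon_tree.
- by move=> n e z; apply: (@wf_norm_le _ _ M); [exact: cf|exact: M0|exact: CM].
- by move=> e z; apply: (@wf_norm_le _ _ M); [exact: cf|exact: M0|exact: CM].
move=> e d d0; have [N osc] := cell_oscillation hcomp Vopen Vbase (cf e) d0.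
pose l := [seq (f e (cell_point V q), pickle (tval q)) | q : N.-tuple bool <- enum {: N.-tuple bool}].
have lE (v : nat -> R * R -> R) z : lin_comb l v z = cell_sum (f e) N (fun s => v (pickle s) z).
  by rewrite /lin_comb /l big_map big_enum.
exists l; split => //.
  move=> n z; rewrite lE.
  have -> : (fun s => w n (pickle s) z) = fun s => wcell (W n) s z by apply/funext => s; rewrite wE.
  by apply: wf_cell_sum => //; exact: ltW.
apply: ae_square_imp aeu => z Hz Iz; have [uD u1] := Hz Iz; rewrite lE.
apply: (tree_graphon_cell_sum ku' (cf e) (ltW d0) Iz) => //.
- by apply: u1 => n z' Iz'; rewrite wE wcell_nil.
- by move=> s; apply: uD => n z'; rewrite !wE; exact: wcell_split.
(* For an empty cell the relation 0 = 0 + 0 makes [u' s z] equal to its double. *)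
move=> s s0; have : u' s z = u' s z + u' s z.
  by apply: uD => n z'; rewrite !wE !wcell_empty// addr0.
by move/eqP; rewrite -subr_eq subrr eq_sym => /eqP.
Qed.

End Graphon.

Lemma countable_base (K : ptopologicalType) : @second_countable K -> exists V : nat -> set K,
  (forall i, open (V i)) /\ forall x O, nbhs x O -> exists2 i, V i x & V i `<=` O.
Proof.
move=> [B /pfcard_geP[B0|[V]] [Bopen Bbase]].
  by have [A [BA _] _] := Bbase point _ (filterT : nbhs point setT); move: BA; rewrite B0.
exists V; split => [i|x A xA]; first by apply: Bopen; exact: funS.
have [A' [BA' A'x] A'A] := Bbase x _ xA.
by have [i _ iA'] : (V @` setT) A' := surj BA'; exists i; rewrite iA'.
Qed.

(** * From the generating set to all continuous decorations *)

Section Density.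
Context {R : realType} {K : ptopologicalType}.
Hypothesis hcomp : compact [set: K].
Implicit Types (W : R * R -> PK R K) (f : K -> R).
Local Notation I := (@I01 R).

Lemma tdensE k (F : 'I_k -> 'I_k -> K -> R) W :
  tdens F W = hom (fun e => wf W (F e.1 e.2)).
Proof.
rewrite /tdens iter_intE; apply: eq_iter_mean => v vI _.
rewrite pair_big_dep /hom_integrand /edges big_filter; apply: eq_bigr => -[i j] _ /=.
have Iv (m : 'I_k) : I (v m) by apply: (vI m); rewrite mem_rev mem_iota /=.
by rewrite (@wfE _ _ W (F i j) (v i, v j) (conj (Iv i) (Iv j))).
Qed.

Lemma wf_approx W f n (c : 'I_n -> R) (h : 'I_n -> K -> R) d z :
  continuous f -> (forall i, continuous (h i)) -> 0 <= d ->
  (forall x, `|f x - \sum_i c i * h i x| <= d) ->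
  `|wf W f z - \sum_i c i * wf W (h i) z| <= d.
Proof.
move=> cf ch d0 fh; have [Iz|Iz] := pselect ((I `*` I) z); last first.
  by rewrite wf_out// big1 ?subrr ?normr0// => i _; rewrite wf_out// mulr0.
pose mu := W z : probability (borelK K) R.
have P1 : mu setT = 1%E by exact: probability_setT.
have bf := bounded_continuous hcomp cf.
have bh i : bounded_meas (h i : borelK K -> R) by exact: bounded_continuous.
have bch i : bounded_meas (fun x : borelK K => c i * h i x) by exact: bounded_measZ.
rewrite wfE// -/mu; have -> : \sum_i c i * wf W (h i) z =
    Rintegral mu setT (fun x => \sum_i c i * h i x).
  rewrite (@mean_sum _ _ _ mu setT measurableT P1 _ _ _ _ bch); apply: eq_bigr => i _.
  by rewrite wfE// (@meanZ _ _ _ mu setT measurableT P1 _ _ (bh i)).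
have bS : bounded_meas (fun x : borelK K => \sum_i c i * h i x).
  by apply: bounded_meas_sum => i; exact: bch.
rewrite -(@meanB _ _ _ mu setT measurableT P1 _ _ bf bS).
apply: (@mean_norm_le _ _ _ mu setT measurableT P1); first exact: bounded_measB.
by move=> x _; exact: fh.
Qed.

(** An empty family spans only 0, which is at distance 1 from the constant 1. *)
Lemma generating_nonempty (Fs : set (K -> R)) : generating Fs -> exists f, Fs f.
Proof.
move=> [_ H]; have [[|n] [c [h [Fh /(_ point)]]]] := H (fun=> 1) (fun=> cvg_cst (1 : R)) 1 ltr01.
  by rewrite big_ord0 subr0 normr1 ltxx.
by exists (h ord0).
Qed.

Lemma tdens_closure_cvg (Fs : set (K -> R)) W0 (W : nat -> R * R -> PK R K) :
  generating Fs -> Kgraphon W0 -> (forall n, Kgraphon (W n)) ->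
  forall k, (forall F : 'I_k -> 'I_k -> K -> R, decorated Fs F ->
    tdens F (W n) @[n --> \oo] --> tdens F W0) ->
  forall F : 'I_k -> 'I_k -> K -> R, decorated (@contK R K) F ->
    tdens F (W n) @[n --> \oo] --> tdens F W0.
Proof.
move=> hgen gW0 gW k cF F [_ dF]; have [FsC Fsapp] := hgen.
rewrite tdensE; under eq_fun do rewrite tdensE.
have cF' e : continuous (F e.1 e.2) by exact: dF.
have /choice[C hC] : forall e : 'I_k * 'I_k, exists C, 0 <= C /\ forall x, `|F e.1 e.2 x| <= C.
  move=> e; have [_ [C hC]] := bounded_continuous hcomp (cF' e); exists C; split => //.
  by apply: le_trans (hC point).
pose M := \sum_e C e.
have CM e x : `|F e.1 e.2 x| <= M.
  apply: le_trans ((hC e).2 x) _; rewrite /M (bigD1 e)//= lerDl sumr_ge0// => i _.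
  exact: (hC i).1.
have M0 : 0 <= M by apply: sumr_ge0 => e _; exact: (hC e).1.
apply: (@hom_closure_cvg _ (K -> R) Fs \oo _ (fun n => wf (W n)) (wf W0) _ _ k _ _ _ M).
- by move=> n f /FsC cf; exact: bounded_meas_wf.
- by move=> f /FsC cf; exact: bounded_meas_wf.
- move=> f Ff.
  (* An arbitrary labelling of the edges is symmetrized into a decorated graph; the density reads
     only the entries with [i < j], which are unchanged. *)
  pose G (i j : 'I_k) := if (i < j)%N then f (i, j) else f (j, i).
  have dG : decorated Fs G.
    split => i j; rewrite /G; last by case: ifP => _; exact: Ff.
    by case: ltngtP => // ij; rewrite (val_inj ij).
  have homG W' : hom (fun e => wf W' (f e)) = tdens G W'.
    rewrite tdensE; apply: hom_ext => -[i j]; rewrite mem_edges /= => ij.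
    by rewrite /G ij.
  by rewrite homG; under eq_fun do rewrite homG; exact: cF.
- exact: generating_nonempty hgen.
- by move=> n e; exact: bounded_meas_wf.
- by move=> e; exact: bounded_meas_wf.
- by move=> n e z; apply: (@wf_norm_le _ _ hcomp _ _ M); [exact: cF'|exact: M0|exact: CM].
- by move=> e z; apply: (@wf_norm_le _ _ hcomp _ _ M); [exact: cF'|exact: M0|exact: CM].
move=> e d d0; have [n [c [h [Fh fh]]]] := Fsapp _ (cF' e) d d0.
have app W' z : `|wf W' (F e.1 e.2) z -
    lin_comb [seq (c i, h i) | i <- enum 'I_n] (wf W') z| <= d.
  rewrite /lin_comb big_map big_enum /=; apply: wf_approx => //.
  - by move=> i; exact: FsC.
  - exact: ltW.
  - by move=> x; exact: ltW.
exists [seq (c i, h i) | i <- enum 'I_n]; split => //.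
  move=> i x; rewrite size_map size_enum_ord => ni.
  by rewrite (nth_map (Ordinal ni)) ?size_enum_ord//=; exact: Fh.
by apply: aeW => z _; exact: app.
Qed.

End Density.

Unset Implicit Arguments.

Theorem theorem3 (R : realType) (K : ptopologicalType)
  (hcomp : compact [set: K]) (hsc : @second_countable K) (hhaus : hausdorff_space K)
  (Fs : set (K -> R)) (hcount : countable Fs) (hgen : generating Fs)
  (W : nat -> R * R -> PK R K) (hW : forall n, Kgraphon (W n))
  (hconv : forall (k : nat) (F : 'I_k -> 'I_k -> K -> R), decorated Fs F ->
     cvg (tdens F (W n) @[n --> \oo])) :
  exists W0 : R * R -> PK R K, Kgraphon W0 /\
    forall (k : nat) (F : 'I_k -> 'I_k -> K -> R), decorated (@contK R K) F ->
      tdens F (W n) @[n --> \oo] --> tdens F W0.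
Proof.
have [V [Vopen Vbase]] := countable_base hsc.
have [U [UU ooU]] := ultraFilterLemma (F := \oo) _.
have [W0 gW0 cW0] := graphon_compactness hcomp hhaus Vopen Vbase UU hW.
exists W0; split => // k; apply: (tdens_closure_cvg hcomp hgen) => // F dF.
have /cvg_ex[l cl] := hconv k F dF.
(* [W0] comes from [U] and [l] from [\oo]. As [U] is finer, both are limits along [U], and limits of
   reals along it are unique. *)
suff <- : l = tdens F W0 by [].
have clU : tdens F (W n) @[n --> U] --> l.
  by apply: cvg_trans cl; apply: cvg_app; exact: ooU.
have cU : tdens F (W n) @[n --> U] --> tdens F W0.
  rewrite tdensE; under eq_fun do rewrite tdensE; apply: cW0 => e.
  by apply: hgen.1; exact: dF.2.
exact: (cvg_unique _ clU cU).
Qed.
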